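(* Let $N\ge 1$, let $V$ be a set of $N$ vertices, and let $(\beta_k)_{k\ge1}$ be non-negative reals with $\sum_{k\ge1} k\beta_k<\infty$. Let $\Lambda$ be the Poisson random hypergraph on $V$ with parameters $(\beta_k)$, let $\beta(t)=\sum_{k\ge1}\beta_k t^k$ and $t^*=\inf\{t\ge 0:\beta'(t)+\log(1-t)<0\}$, and assume that $\beta'(t)+\log(1-t)$ has no zeros in $[0,t^* )$. Let $\mathcal{E}(N,k)$ be the number of essential $k$-edges of $\Lambda$ and $\mathcal{E}(N)=\sum_{k=1}^N\mathcal{E}(N,k)$. Then, as $N\to\infty$, the following convergences hold in probability: $$\frac{\mathcal{E}(N,k)}{N}\to k(1-t^* )(t^* )^{k-1}\beta_k \quad\text{for every } k\ge 1,\qquad \frac{\mathcal{E}(N)}{N}\to -(1-t^* )\log(1-t^* ).$$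
   Context: A Poisson random hypergraph on $V$ with parameters $(\beta_k)_{k\ge1}$ is a random map $\Lambda:\mathcal{P}(V)\to\mathbb{Z}^+$ such that the $\Lambda(A)$, $A\subseteq V$, are independent and $\Lambda(A)\sim\mathrm{Poisson}(N\beta_k/\binom{N}{k})$ when $|A|=k$; $\Lambda(A)$ is the number of hyperedges over $A$ (multiple hyperedges allowed), and a hyperedge over a set of size $k$ is a $k$-edge; 1-edges are called patches. Identifiable vertices: repeatedly pick a vertex carrying a patch, delete that vertex and the patch, and collapse every other hyperedge containing it onto its remaining vertices (e.g. a 3-edge over $\{u,v,w\}$ becomes a 2-edge over $\{u,w\}$); continue until no patches remain. The set of vertices removed does not depend on the order of choices; it is the set $V^*(\Lambda)$ of identifiable vertices. A hyperedge is essential if removing it (before the collapse) reduces the number of identifiable vertices. *)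

(* Defs.v *)
From HB Require Import structures.
From mathcomp Require Import all_boot all_order all_algebra.
From mathcomp Require Import all_classical all_reals.
From mathcomp Require Import ereal topology normedtype sequences exp esum.
Set Implicit Arguments. Unset Strict Implicit. Unset Printing Implicit Defensive.
Import Order.TTheory GRing.Theory Num.Theory.
Import numFieldTopology.Exports numFieldNormedType.Exports.
Local Open Scope ring_scope.


(* A (multi-)hypergraph on the vertex set V = 'I_N : Lambda A = number of
   hyperedges over A. *)
Definition hypergraph (N : nat) := {ffun {set 'I_N} -> nat}.

(* After the vertices of S have been removed, a hyperedge over A has been
   collapsed onto A :\: S; it is a patch at v iff A :\: S = {v}. *)
Definition has_patch N (L : hypergraph N) (S : {set 'I_N}) (v : 'I_N) : bool :=
  [exists A : {set 'I_N}, (0 < L A)%N && (A :\: S == [set v])].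

(* one step: pick a vertex carrying a patch and remove it (the choice is the
   canonical [pick]; the paper notes the result is choice-independent). *)
Definition peel_step N (L : hypergraph N) (S : {set 'I_N}) : {set 'I_N} :=
  if [pick v | has_patch L S v] is Some v then v |: S else S.

(* each effective step removes a new vertex, so N steps suffice to reach the
   end of the process *)
Definition identifiable N (L : hypergraph N) : {set 'I_N} :=
  iter N (peel_step L) finset.set0.

Definition remove_edge N (L : hypergraph N) (A : {set 'I_N}) : hypergraph N :=
  [ffun B => if B == A then (L B).-1 else L B].

Definition essential_k N (L : hypergraph N) (k : nat) : nat :=
  (\sum_(A : {set 'I_N} | #|A| == k)
     (if #|identifiable (remove_edge L A)| < #|identifiable L| then L A else 0))%N.

Definition essential N (L : hypergraph N) : nat :=
  (\sum_(1 <= k < N.+1) essential_k L k)%N.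

Definition poisson_mass {R : realType} (lam : R) (n : nat) : R :=
  expR (- lam) * lam ^+ n / (n`!)%:R.

(* Lambda(A) ~ Poisson(N beta_k / C(N,k)) for |A| = k >= 1 (no hyperedges
   over the empty set: the parameters are indexed by k >= 1). *)
Definition hyper_rate {R : realType} (beta : nat -> R) N (A : {set 'I_N}) : R :=
  if #|A| == 0%N then 0 else N%:R * beta #|A| / ('C(N, #|A|))%:R.

Definition hyper_mass {R : realType} (beta : nat -> R) N (L : hypergraph N) : R :=
  \prod_(A : {set 'I_N}) poisson_mass (hyper_rate beta A) (L A).

Definition hyper_prob {R : realType} (beta : nat -> R) N
  (E : set (hypergraph N)) : \bar R :=
  (\esum_(L in E) (hyper_mass beta L)%:E)%E.

Definition beta_deriv {R : realType} (beta : nat -> R) (t : R) : R :=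
  limn (fun n => \sum_(1 <= k < n) k%:R * beta k * t ^+ k.-1).

(* t* = inf { t >= 0 : beta'(t) + log(1-t) < 0 } (log(1-t) is only defined
   for t < 1) *)
Definition tstar {R : realType} (beta : nat -> R) : R :=
  inf [set t : R | 0 <= t /\ t < 1 /\ beta_deriv beta t + ln (1 - t) < 0]%classic.

(* Main.v *)
Require Import Defs.
From HB Require Import structures.
From mathcomp Require Import all_boot all_order all_algebra.
From mathcomp Require Import all_classical all_reals.
From mathcomp Require Import ereal topology normedtype sequences exp esum derive.
From mathcomp Require Import polyrcf ring lra zify.
Set Implicit Arguments.
Unset Strict Implicit.
Unset Printing Implicit Defensive.
Import Order.TTheory GRing.Theory Num.Theory.
Import numFieldTopology.Exports numFieldNormedType.Exports.
Local Open Scope classical_set_scope.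
Local Open Scope ring_scope.

(** Write [V^*] for the identifiable set and [X = #|V^*|]. The event [V^* = T] says
    that the hyperedges inside [T] identify [T] and that no hyperedge leaves [T] in
    exactly one vertex; the two conditions are independent, and the second has
    probability [q_n ^ (N - n)] with [n = #|T|]. Hence
    [P(X = n) = 'C(N, n) f_n q_n ^ (N - n)], where the [f_n] solve
    [\sum_n 'C(m, n) f_n q_n ^ (m - n) = 1] for all [m]: they are values at 1 of
    Goncarov polynomials, so they are nonnegative for every nonincreasing [q].
    The same recursion at [m = N, N - 1, N - 2] shows that [(1 - X / N) / q_X] has mean
    1 and variance [O(1 / N)]. As this ratio is close to
    [exp (beta'(X / N) + log (1 - X / N))], [X / N] concentrates near the zeros of the
    exponent; freezing [q] just above [t^*] discards the zeros beyond [t^*].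

    For the count [Z] of essential hyperedges, the Mecke formula gives [E Z = E W], with
    [W] the total rate of the hyperedges that would enlarge [V^*]; [W] is a function of
    [X]. Applied twice, it bounds [E (Z - c)^2] by [E (W - c)^2] plus [O(N)] plus an
    influence term controlled by the covariance of [X] with the number of hyperedges,
    which is [O(N ^ (3 / 2))]. Chebyshev's inequality concludes. *)

(** * Peeling, closed sets, and the effect of one more hyperedge *)

Section Peeling.
Variable N : nat.
Implicit Types (L : hypergraph N) (A B S T : {set 'I_N}) (v : 'I_N).

(** The sets at which peeling stops. [identifiable L] is the least of them ([identifiable_closed],
    [identifiable_sub]), and this is how later proofs use it. *)
Definition closed_under L S : bool :=
  [forall A : {set 'I_N}, (0 < L A)%N ==> (#|A :\: S| != 1)%N].

Lemma closed_underP L S :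
  reflect (forall A, (0 < L A)%N -> #|A :\: S| != 1%N) (closed_under L S).
Proof.
by apply: (iffP forallP) => H A; [move/implyP: (H A)|apply/implyP/H].
Qed.

Lemma has_patchPn L S : closed_under L S = [forall v, ~~ has_patch L S v].
Proof.
apply/closed_underP/forallP => [H v|H A LA].
  apply/negP => /existsP[A /andP[LA /eqP AS]].
  by have := H A LA; rewrite AS cards1.
apply/negP => /cards1P[v AS]; have /negP := H v; apply.
by apply/existsP; exists A; rewrite LA AS eqxx.
Qed.

Lemma has_patch_notin L S v : has_patch L S v -> v \notin S.
Proof.
case/existsP => A /andP[_ /eqP AS].
by have := set11 v; rewrite -AS inE => /andP[].
Qed.

(** A step that finds a patch adds a new vertex; a step that finds none has reached a closed set,
    which every later step leaves fixed. *)
Lemma iter_peel_step_card L n :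
  (n <= #|iter n (peel_step L) finset.set0|)%N
  \/ closed_under L (iter n (peel_step L) finset.set0).
Proof.
elim: n => [|n [IH|IH]]; first by left.
- rewrite iterS {1 3}/peel_step; case: pickP => [v vP|noP].
    by left; rewrite cardsU1 (has_patch_notin vP) add1n ltnS.
  by right; rewrite has_patchPn; apply/forallP => v; rewrite noP.
- right; rewrite iterS /peel_step; case: pickP => [v vP|noP]; last by [].
  by move: IH; rewrite has_patchPn => /forallP/(_ v); rewrite vP.
Qed.

Lemma identifiable_closed L : closed_under L (identifiable L).
Proof.
have [Nle|//] := iter_peel_step_card L N.
have /eqP E : identifiable L == finset.setT.
  by rewrite eqEcard finset.subsetT cardsT card_ord.
apply/closed_underP => A _.
have -> : A :\: identifiable L = finset.set0 by rewrite E finset.setDT.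
by rewrite cards0.
Qed.

(** Peeling never exits [S]: if the current set lies in [S] and [A] leaves it in the single vertex
    [v], then [v] outside [S] would make [A] leave [S] in exactly [v]. *)
Lemma identifiable_sub L S : closed_under L S -> identifiable L \subset S.
Proof.
move=> /closed_underP cS; rewrite /identifiable.
suff H n : iter n (peel_step L) finset.set0 \subset S by exact: H.
elim: n => [|n IH]; first by rewrite finset.sub0set.
rewrite iterS /peel_step; case: pickP => // v /existsP[A /andP[LA /eqP AT]].
rewrite finset.subUset IH andbT finset.sub1set; apply: contraT => vS.
have /negP[] := cS A LA; apply/cards1P; exists v.
apply/eqP; rewrite finset.eqEsubset; apply/andP; split; last first.
  rewrite finset.sub1set inE vS /=.
  by have := set11 v; rewrite -AT inE => /andP[].
by rewrite -AT finset.setDS.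
Qed.

Lemma identifiable_mono L L' :
  (forall A, 0 < L A -> 0 < L' A)%N -> identifiable L \subset identifiable L'.
Proof.
move=> LL'; apply: identifiable_sub; apply/closed_underP => A /LL'.
by move/closed_underP: (identifiable_closed L') => /(_ A).
Qed.

Definition restrict L S : hypergraph N :=
  [ffun A : {set 'I_N} => if A \subset S then L A else 0%N].

Lemma restrict_setT L : restrict L finset.setT = L.
Proof. by apply/ffunP => A; rewrite ffunE finset.subsetT. Qed.

Lemma identifiable_restrict_sub L S : identifiable (restrict L S) \subset S.
Proof.
apply: identifiable_sub; apply/closed_underP => A; rewrite ffunE.
case: ifP => // AS _; move: AS; rewrite -finset.setD_eq0 => /eqP ->.
by rewrite cards0.
Qed.

Definition boundary T S A : bool := (A \subset S) && (#|A :\: T| == 1%N).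

(** Hyperedges leaving [T] in two or more vertices stay inert while peeling inside [T]. What remains
    are the hyperedges inside [T] and those leaving it in one vertex: disjoint families, hence the
    independence of the two conditions. *)
Lemma identifiable_restrict_eq L S T : T \subset S ->
  (identifiable (restrict L S) == T) =
  (identifiable (restrict L T) == T)
  && [forall (A : {set 'I_N} | boundary T S A), L A == 0%N].
Proof.
move=> TS; apply/eqP/andP => [E|[/eqP E /forall_inP F]].
- have cT := identifiable_closed (restrict L S); rewrite E in cT.
  split; last first.
    apply/forall_inP => A /andP[AS A1]; apply: contraT; rewrite -lt0n => LA.
    by move/closed_underP: cT => /(_ A); rewrite ffunE AS A1 => /(_ LA).
  rewrite finset.eqEsubset identifiable_restrict_sub /=.
  set U := identifiable (restrict L T).
  have UT : U \subset T := identifiable_restrict_sub L T.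
  suff : identifiable (restrict L S) \subset U by rewrite E.
  apply: identifiable_sub; apply/closed_underP => A; rewrite ffunE.
  case: ifP => // AS LA; case AT: (A \subset T).
    move/closed_underP: (identifiable_closed (restrict L T)) => /(_ A).
    by rewrite ffunE AT; apply.
  (* [A] leaves [T] in at least two points because [T] is closed. *)
  have : #|A :\: T| != 1%N.
    by move/closed_underP: cT => /(_ A); rewrite ffunE AS; apply.
  have : #|A :\: T| != 0%N by rewrite cards_eq0 finset.setD_eq0 AT.
  have : (#|A :\: T| <= #|A :\: U|)%N by apply: subset_leq_card; rewrite finset.setDS.
  lia.
- apply/eqP; rewrite finset.eqEsubset; apply/andP; split.
    apply: identifiable_sub; apply/closed_underP => A; rewrite ffunE.
    case: ifP => // AS LA; apply/negP => A1.
    by have := F A; rewrite /boundary AS A1 => /(_ isT)/eqP E0; rewrite E0 in LA.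
  rewrite -{1}E; apply: identifiable_mono => A; rewrite !ffunE.
  by case: ifP => // AT; rewrite (fintype.subset_trans AT TS).
Qed.

Definition add_edge L A : hypergraph N := [ffun B => (L B + (B == A))%N].

(** Once [identifiable L] is removed, a hyperedge over [A] would be a patch and would restart the
    peeling. *)
Definition completes L A : bool := #|A :\: identifiable L| == 1%N.

Lemma add_edgeK A : cancel (add_edge^~ A) (@remove_edge N ^~ A).
Proof.
by move=> L; apply/ffunP => B; rewrite !ffunE; case: eqP; rewrite ?addn1 ?addn0.
Qed.

Lemma remove_edgeK L A : (0 < L A)%N -> add_edge (remove_edge L A) A = L.
Proof.
move=> LA; apply/ffunP => B; rewrite !ffunE; case: eqP => [->|_].
  by rewrite addn1 prednK.
by rewrite addn0.
Qed.

Lemma identifiable_add_edge_sub L A :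
  identifiable L \subset identifiable (add_edge L A).
Proof. by apply: identifiable_mono => B LB; rewrite ffunE addn_gt0 LB. Qed.

(** If [A] does not complete, the old identifiable set is still closed after the addition; if it
    does, that set is no longer closed, so the new one is strictly larger. *)
Lemma identifiable_add_edge_lt L A :
  (#|identifiable L| < #|identifiable (add_edge L A)|)%N = completes L A.
Proof.
have sub := identifiable_add_edge_sub L A.
apply/idP/idP => [lt|c1].
  apply: contraLR lt => nc; rewrite -leqNgt subset_leq_card //.
  apply: identifiable_sub; apply/closed_underP => B; rewrite ffunE.
  case: (B =P A) => [-> _|_]; first exact: nc.
  by rewrite addn0; move/closed_underP: (identifiable_closed L) => /(_ B).
apply: proper_card; rewrite properE sub /=; apply/negP => sub'.
have E : identifiable (add_edge L A) = identifiable L.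
  by apply/eqP; rewrite finset.eqEsubset sub' sub.
have := identifiable_closed (add_edge L A); rewrite E => /closed_underP/(_ A).
by rewrite ffunE eqxx addn1 => /(_ isT); rewrite -/(completes L A) c1.
Qed.

End Peeling.

(** * Expectations under the Poisson law and the Mecke formula *)

Lemma esumZl (R : realType) (T : choiceType) (D : set T) (c : R) (a : T -> \bar R) :
  0 <= c -> (forall x, 0 <= a x)%E ->
  (\esum_(x in D) (c%:E * a x) = c%:E * \esum_(x in D) a x)%E.
Proof.
move=> c0 a0; rewrite /esum -ereal_supZl //; last first.
  apply/set0P; exists 0%E; exists set0; first exact: fsets_set0.
  by rewrite fsbig_set0.
congr (ereal_sup _); rewrite image_comp; apply: eq_imagel => X [finX XD] /=.
by rewrite ge0_mule_fsumr.
Qed.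

Section Expectation.
Variables (R : realType) (beta : nat -> R) (N : nat).
Hypothesis rate_ge0 : forall A : {set 'I_N}, 0 <= hyper_rate beta A.
Implicit Types (L : hypergraph N) (A B : {set 'I_N}) (h F : hypergraph N -> R).

Local Notation rate := (hyper_rate beta).
Local Notation mass := (hyper_mass beta).

Definition hyper_expect h : \bar R :=
  (\esum_(L in [set: hypergraph N]) (mass L * h L)%:E)%E.
Local Notation EE := hyper_expect.

Lemma poisson_mass_ge0 (lam : R) n : 0 <= lam -> 0 <= poisson_mass lam n.
Proof.
by move=> lam0; rewrite /poisson_mass mulr_ge0 ?invr_ge0// mulr_ge0 ?expR_ge0 ?exprn_ge0.
Qed.

Lemma poisson_massS (lam : R) n :
  poisson_mass lam n.+1 * n.+1%:R = lam * poisson_mass lam n.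
Proof.
rewrite /poisson_mass factS natrM exprS; field.
by rewrite ?nat1r !pnatr_eq0 -!lt0n fact_gt0.
Qed.

Lemma hyper_mass_ge0 L : 0 <= mass L.
Proof. by apply: prodr_ge0 => A _; apply: poisson_mass_ge0. Qed.

Lemma hyper_mass_add_edge L A :
  mass (add_edge L A) * (L A).+1%:R = rate A * mass L.
Proof.
rewrite /hyper_mass (bigD1 A) //= [in RHS](bigD1 A) //= ffunE eqxx addn1.
rewrite mulrAC poisson_massS -mulrA; congr (_ * (_ * _)).
by apply: eq_bigr => B /negPf BA; rewrite ffunE BA addn0.
Qed.

Lemma hyper_expect_ge0 h : (forall L, 0 <= h L) -> (0 <= EE h)%E.
Proof. by move=> h0; apply: esum_ge0 => L _; rewrite lee_fin mulr_ge0 ?hyper_mass_ge0. Qed.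

Lemma le_hyper_expect h h' : (forall L, h L <= h' L) -> (EE h <= EE h')%E.
Proof.
by move=> hh; apply: le_esum => L _; rewrite lee_fin ler_wpM2l ?hyper_mass_ge0.
Qed.

Lemma eq_hyper_expect h h' : h =1 h' -> EE h = EE h'.
Proof. by move=> e; apply: eq_esum => L _; rewrite e. Qed.

Lemma hyper_expectD h h' : (forall L, 0 <= h L) -> (forall L, 0 <= h' L) ->
  EE (fun L => h L + h' L) = (EE h + EE h')%E.
Proof.
move=> h0 h'0; rewrite /hyper_expect -esumD.
- by apply: eq_esum => L _; rewrite mulrDr EFinD.
- by move=> L _; rewrite lee_fin mulr_ge0 ?hyper_mass_ge0.
- by move=> L _; rewrite lee_fin mulr_ge0 ?hyper_mass_ge0.
Qed.

Lemma hyper_expectZ c h : 0 <= c -> (forall L, 0 <= h L) ->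
  EE (fun L => c * h L) = (c%:E * EE h)%E.
Proof.
move=> c0 h0; rewrite /hyper_expect -esumZl //.
  by apply: eq_esum => L _; rewrite -EFinM mulrCA.
by move=> L; rewrite lee_fin mulr_ge0 ?hyper_mass_ge0.
Qed.

Lemma hyper_expect_sum (I : choiceType) (r : seq I) (P : pred I)
    (h : I -> hypergraph N -> R) :
  (forall i L, P i -> 0 <= h i L) ->
  EE (fun L => \sum_(i <- r | P i) h i L) = (\sum_(i <- r | P i) EE (h i))%E.
Proof.
move=> h0; rewrite /hyper_expect -esum_sum.
  by apply: eq_esum => L _; rewrite mulr_sumr sumEFin.
by move=> L i _ Pi; rewrite lee_fin mulr_ge0 ?hyper_mass_ge0 ?h0.
Qed.

Lemma hyper_probE (E : set (hypergraph N)) :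
  hyper_prob beta E = EE (fun L => (L \in E)%:R).
Proof.
rewrite /hyper_prob esum_mkcond; apply: eq_esum => L _.
by case: (L \in E); rewrite ?mulr1 ?mulr0.
Qed.

(** Adding a hyperedge over [A] is a bijection onto the configurations with [0 < L A], and by
    [hyper_mass_add_edge] it turns the weight [L A] into the rate. *)
Lemma mecke A h : (forall L, 0 <= h L) ->
  EE (fun L => (L A)%:R * h (remove_edge L A)) = ((rate A)%:E * EE h)%E.
Proof.
move=> h0; rewrite -hyper_expectZ //.
have bij : set_bij [set: hypergraph N] [set L : hypergraph N | (0 < L A)%N]
    (@add_edge N ^~ A).
  split=> [L _ /=|L L' _ _ /=|L /= LA]; first by rewrite ffunE eqxx addn1.
    exact: (can_inj (add_edgeK A)).
  by exists (remove_edge L A) => //; rewrite remove_edgeK.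
rewrite /hyper_expect.
(* The factor [L A] kills the configurations with [L A = 0], where the truncated predecessor in
   [remove_edge] would not be inverted by [add_edge]. *)
transitivity (\esum_(L in [set L : hypergraph N | (0 < L A)%N])
   (mass L * ((L A)%:R * h (remove_edge L A)))%:E)%E.
  rewrite [RHS]esum_mkcond; apply: eq_esum => L _; case: ifPn => //.
  rewrite notin_setE /= => /negP; rewrite -leqNgt leqn0 => /eqP ->.
  by rewrite mul0r mulr0.
rewrite (reindex_esum _ _ _ _ bij); apply: eq_esum => L _.
rewrite ffunE eqxx addn1 add_edgeK mulrA hyper_mass_add_edge.
by congr (_%:E); ring.
Qed.

Lemma mecke_add A h : (forall L, 0 <= h L) ->
  EE (fun L => (L A)%:R * h L) = ((rate A)%:E * EE (fun L => h (add_edge L A)))%E.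
Proof.
move=> h0; rewrite -mecke //; apply: eq_hyper_expect => L.
by have [->|LA] := posnP (L A); rewrite ?mul0r // remove_edgeK.
Qed.

(** The hypothesis [hA] says that [h] does not see the coordinate [A]. By the Mecke formula the
    parts [a n] of the expectation carried by [L A = n] satisfy [(n + 1) a_(n+1) = rate * a_n], so
    they sum to [a_0] times the exponential series. *)
Lemma hyper_expect_vanish1 A h : (forall L, 0 <= h L) ->
  (forall L, h (add_edge L A) = h L) ->
  EE h = ((expR (rate A))%:E * EE (fun L => h L * (L A == 0%N)%:R)%R)%E.
Proof.
move=> h0 hA; pose a n := EE (fun L => h L * (L A == n)%:R).
have hn0 n L : 0 <= h L * (L A == n)%:R by rewrite mulr_ge0.
have aE n : a n = ((exp_coeff (rate A) n)%:E * a 0%N)%E.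
  elim: n => [|n IH]; first by rewrite /exp_coeff /= expr0 fact0 divr1 mul1e.
  have /eqP : (n.+1%:R%:E * a n.+1 = (rate A)%:E * a n)%E.
    rewrite /a -hyper_expectZ //.
    rewrite -(_ : EE (fun L => h (add_edge L A) * (add_edge L A A == n.+1)%:R)
        = EE (fun L => h L * (L A == n)%:R)); last first.
      by apply: eq_hyper_expect => L; rewrite hA ffunE eqxx addn1 eqSS.
    rewrite -(mecke_add A (h := fun L => h L * (L A == n.+1)%:R)) //.
    apply: eq_hyper_expect => L; case: eqP => [->|_] //.
    by rewrite !mulr0.
  rewrite IH => /eqP E.
  have : ((n.+1%:R^-1)%:E * (n.+1%:R%:E * a n.+1) =
     (n.+1%:R^-1)%:E * ((rate A)%:E * ((exp_coeff (rate A) n)%:E * a 0%N)))%E by rewrite E.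
  rewrite !muleA -!EFinM mulVf ?pnatr_eq0 // mul1e => ->.
  congr (_%:E * _)%E; rewrite /exp_coeff /= factS natrM exprS; field.
  by rewrite ?nat1r !pnatr_eq0 -!lt0n fact_gt0.
have a0_ge0 : (0 <= a 0%N)%E by apply: hyper_expect_ge0.
have -> : EE h = (\sum_(0 <= n <oo) a n)%E.
  transitivity (\sum_(0 <= n <oo) \esum_(L in [set L : hypergraph N | L A = n])
     (mass L * h L)%:E)%E; last first.
    apply: eq_eseriesr => n _; rewrite /a /hyper_expect esum_mkcond.
    apply: eq_esum => L _; case: ifPn => [/set_mem/= ->|].
      by rewrite eqxx mulr1.
    by rewrite notin_setE /= => /eqP/negPf ->; rewrite !mulr0.
  rewrite -nneseries_sum_bigcup.
  - congr (esum _ _); apply/seteqP; split => // L _; by exists (L A).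
  - by move=> m n _ _ [L [/= <- <-]].
  - by move=> L; rewrite lee_fin mulr_ge0 ?hyper_mass_ge0.
under eq_eseriesr do rewrite aE.
have e0 n : 0 <= exp_coeff (rate A) n by apply: exp_coeff_ge0.
have sE : (\sum_(0 <= n <oo) (exp_coeff (rate A) n)%:E = (expR (rate A))%:E)%E.
  rewrite /expR -EFin_lim; last exact: is_cvg_series_exp_coeff.
  by congr (lim (_ @ \oo)); apply/funext => n /=; rewrite /series /= sumEFin.
case Ea : (a 0%N) a0_ge0 => [r||] // a0_ge0.
- under eq_eseriesr do rewrite muleC.
  by rewrite nneseriesZl ?sE -/(a 0%N) ?Ea 1?muleC // => n _; rewrite lee_fin.
(* If [a 0] is infinite, the first term already makes the series infinite. *)
- rewrite -/(a 0%N) Ea gt0_muley ?lte_fin ?expR_gt0 //.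
  apply/eqP; rewrite -leye_eq.
  have t0 n : (0 <= (exp_coeff (rate A) n)%:E * +oo :> \bar R)%E.
    by rewrite mule_ge0 // lee_fin.
  rewrite nneseries_recl // {1}/exp_coeff /= expr0 fact0 divr1 mul1e.
  by rewrite leeDl // nneseries_ge0.
Qed.

Lemma hyper_expect_vanish (s : seq {set 'I_N}) h : uniq s ->
  (forall L, 0 <= h L) -> (forall A L, A \in s -> h (add_edge L A) = h L) ->
  EE (fun L => h L * (all (fun A => L A == 0%N) s)%:R)
  = ((expR (- \sum_(A <- s) rate A))%:E * EE h)%E.
Proof.
move=> + h0; elim: s => [_ _|A s IH /= /andP[As us] hs].
  rewrite big_nil oppr0 expR0 mul1e; apply: eq_hyper_expect => L.
  by rewrite mulr1.
have hs' B L : B \in s -> h (add_edge L B) = h L.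
  by move=> Bs; rewrite hs // in_cons Bs orbT.
pose g L := h L * (all (fun A => L A == 0%N) s)%:R.
have gA L : g (add_edge L A) = g L.
  rewrite /g hs ?mem_head //; congr (_ * _%:R); congr nat_of_bool.
  apply: eq_in_all => B Bs; rewrite ffunE; case: (B =P A) => [BA|_]; last by rewrite addn0.
  by rewrite -BA Bs in As.
have g0 L : 0 <= g L by rewrite mulr_ge0.
have := hyper_expect_vanish1 g0 gA; rewrite IH // => /eqP.
rewrite big_cons opprD expRD EFinM -muleA => /eqP ->.
rewrite muleA -EFinM mulrC expRxMexpNx_1 mul1e.
apply: eq_hyper_expect => L; rewrite /g andbC -mulrA -natrM mulnb //.
Qed.

(** Take [h = 1] and all sets in [hyper_expect_vanish]: the left side is the mass of the empty
    hypergraph, which is exactly the exponential factor on the right, so the total mass is 1. *)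
Lemma hyper_expect1 : EE (fun=> 1) = 1%E.
Proof.
have := @hyper_expect_vanish (enum {: {set 'I_N}}) (fun=> 1) (enum_uniq _)
  (fun=> ler01) (fun _ _ _ => erefl).
set s := \sum_(_ <- _) _.
rewrite [LHS](_ : _ = (expR (- s))%:E).
  move=> /(congr1 (fun x => ((expR s)%:E * x)%E)).
  by rewrite muleA -EFinM expRxMexpNx_1 mul1e.
pose Z : hypergraph N := [ffun=> 0%N].
rewrite /hyper_expect.
transitivity (\esum_(L in [set Z]) (mass L)%:E)%E.
  rewrite [RHS]esum_mkcond; apply: eq_esum => L _; rewrite mul1r.
  have -> : all (fun A => L A == 0%N) (enum {: {set 'I_N}}) = (L \in [set Z]).
    apply/idP/idP => [/allP H|/set_mem -> /=].
      apply/mem_set => /=; apply/ffunP => A; rewrite ffunE.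
      by apply/eqP/H; rewrite mem_enum.
    by apply/allP => A _; rewrite ffunE.
  by case: ifP => _; rewrite ?mulr1 ?mulr0.
rewrite esum_set1 ?lee_fin ?hyper_mass_ge0 //; congr (_%:E).
rewrite /s big_enum /= -sumrN expR_sum; apply: eq_bigr => A _.
by rewrite ffunE /poisson_mass expr0 fact0 divr1 mulr1.
Qed.

Lemma hyper_expect_cst c : 0 <= c -> EE (fun=> c) = c%:E.
Proof.
move=> c0; have := @hyper_expectZ c (fun=> 1) c0 (fun=> ler01).
by rewrite hyper_expect1 mule1 => <-; apply: eq_hyper_expect => L; rewrite mulr1.
Qed.

End Expectation.

(** * Goncarov polynomials *)

Section Goncarov.
Variable R : realType.
Implicit Types (p : {poly R}) (q : nat -> R).

(* The constant coefficient is the junk value [p`_0 / 0 = 0]. *)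
Definition primitive p : {poly R} := \poly_(i < (size p).+1) (p`_i.-1 / i%:R).

Lemma deriv_primitive p : (primitive p)^`() = p.
Proof.
apply/polyP => i; rewrite coef_deriv coef_poly ltnS /=; case: ltnP => ip.
  by rewrite -[LHS]mulr_natr divfK ?pnatr_eq0.
by rewrite mul0rn nth_default.
Qed.

Lemma eq_poly_deriv (p1 p2 : {poly R}) a :
  p1^`() = p2^`() -> p1.[a] = p2.[a] -> p1 = p2.
Proof.
move=> dE aE; have d0 : p1 - p2 = ((p1 - p2)`_0)%:P.
  apply/polyP => -[|i]; rewrite coefC //=.
  have : (p1 - p2)^`()`_i = 0 by rewrite derivB dE subrr coef0.
  by rewrite coef_deriv => /eqP; rewrite mulrn_eq0 /= => /eqP.
move: d0; set c := (_`_0) => d0.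
have : (p1 - p2).[a] = 0 by rewrite hornerD hornerN aE subrr.
by rewrite d0 hornerC => c0; apply/eqP; rewrite -subr_eq0 d0 c0.
Qed.

(* Goncarov polynomials: [goncarov q m] vanishes at [q 0], its derivative
   divided by [m] vanishes at [q 1], and so on. *)
Fixpoint goncarov q m : {poly R} :=
  if m is m'.+1 then
    let P := primitive (goncarov (q \o succn) m') in m%:R *: (P - P.[q 0%N]%:P)
  else 1.

Lemma deriv_goncarov q m :
  (goncarov q m.+1)^`() = m.+1%:R *: goncarov (q \o succn) m.
Proof. by rewrite /= derivZ derivB derivC subr0 deriv_primitive. Qed.

Lemma goncarov_root q m : (goncarov q m.+1).[q 0%N] = 0.
Proof. by rewrite /= hornerZ hornerD hornerN hornerC subrr mulr0. Qed.

Lemma eq_goncarov q q' m : (forall i, (i < m)%N -> q i = q' i) ->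
  goncarov q m = goncarov q' m.
Proof.
elim: m q q' => // m IH q q' qq' /=.
by rewrite qq' // (IH _ (q' \o succn)) // => i im; apply: qq'.
Qed.

(** Mean value theorem between the root [q 0] and [x]: the derivative is a Goncarov polynomial of
    the shifted sequence, nonnegative by induction since the intermediate point lies above
    [q 0 >= q 1]. *)
Lemma goncarov_ge0 q m x : (forall i, q i.+1 <= q i) -> q 0%N <= x ->
  0 <= (goncarov q m).[x].
Proof.
elim: m q x => [|m IH] q x qdec qx; first by rewrite hornerC.
move: qx; rewrite le_eqVlt => /predU1P[<-|qx]; first by rewrite goncarov_root.
have [c cI] := polyrcf.poly_mvt (goncarov q m.+1) qx.
rewrite goncarov_root subr0 deriv_goncarov => ->.
apply: mulr_ge0; last by rewrite subr_ge0 ltW.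
rewrite hornerZ; apply: mulr_ge0 => //; apply: IH => [i|/=]; first exact: qdec.
move: cI; rewrite in_itv /= => /andP[qc _].
exact: le_trans (qdec 0%N) (ltW qc).
Qed.

(** Goncarov interpolation of ['X^m]. Both sides have the same derivative, by induction for the
    shifted sequence, and the same value at [q 0], where only the term [i = 0] survives. *)
Lemma goncarov_expansion q m :
  \sum_(i < m.+1) ('C(m, i)%:R * q i ^+ (m - i)) *: goncarov q i = 'X^m.
Proof.
elim: m q => [|m IH] q; first by rewrite big_ord1 bin0 expr0 mulr1 scale1r.
apply: (@eq_poly_deriv _ _ (q 0%N)); last first.
  rewrite horner_sum big_ord_recl big1 => [|i _]; last first.
    by rewrite hornerZ goncarov_root mulr0.
  by rewrite hornerZ hornerC bin0 mulr1 mul1r subn0 addr0 hornerXn.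
rewrite raddf_sum /= big_ord_recl /= derivZ derivC scaler0 add0r.
rewrite derivXn -(IH (q \o succn)) -scaler_nat scaler_sumr; apply: eq_bigr => i _.
rewrite derivZ deriv_goncarov !scalerA /bump /= add1n subSS; congr (_ *: _).
have := mul_bin_diag m.+1 i => /(congr1 (fun k => k%:R : R)); rewrite !natrM /= => E.
by rewrite mulrAC [_ * i.+1%:R]mulrC -E mulrA.
Qed.

Lemma goncarov1_sum q m :
  \sum_(i < m.+1) 'C(m, i)%:R * (goncarov q i).[1] * q i ^+ (m - i) = 1.
Proof.
have := congr1 (fun p : {poly R} => p.[1]) (goncarov_expansion q m).
rewrite hornerXn expr1n horner_sum => E; rewrite -[RHS]E; apply: eq_bigr => i _.
by rewrite [RHS]hornerZ mulrAC.
Qed.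

End Goncarov.

(** * Mean and variance for the law built from Goncarov values *)

Section GoncarovLaw.
Variables (R : realType) (q : nat -> R) (K : R).
Hypothesis q_gt0 : forall n, 0 < q n.
Hypothesis q_dec : forall n, q n.+1 <= q n.
Hypothesis q0_le1 : q 0%N <= 1.
Hypothesis qV_le : forall n, (q n)^-1 <= K.

(** The sequence [q] is a parameter separate from [N], so that the sizes [N], [N.+1] and [N.+2] can
    be compared for one and the same [q]. *)
Definition goncarov_law (N n : nat) : R :=
  'C(N, n)%:R * (goncarov q n).[1] * q n ^+ (N - n).

Lemma goncarov_law_ge0 N n : 0 <= goncarov_law N n.
Proof. by rewrite !mulr_ge0 ?goncarov_ge0 ?exprn_ge0 // ltW. Qed.

Lemma goncarov_law_sum N : \sum_(n < N.+1) goncarov_law N n = 1.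
Proof. exact: goncarov1_sum. Qed.

(** Each weight [(N.+1 - n) / q n] lowers the size by one, through [(N + 1 - n) 'C(N + 1, n) = (N +
    1) 'C(N, n)]. Moments of the ratio thereby become total masses. *)
Lemma goncarov_law_lower N n :
  goncarov_law N.+1 n * (N.+1 - n)%:R / q n = N.+1%:R * goncarov_law N n.
Proof.
rewrite /goncarov_law; have [nN|Nn] := leqP n N; last first.
  by rewrite (eqP (_ : N.+1 - n == 0)%N) ?subn_eq0 // (bin_small Nn) !(mul0r, mulr0).
have := mul_bin_down N.+1 n => /(congr1 (fun k => k%:R : R)); rewrite !natrM /= => E.
rewrite subSn // exprS.
rewrite subSn // in E.
transitivity ((N - n).+1%:R * 'C(N.+1, n)%:R * ((goncarov q n).[1] * q n ^+ (N - n))).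
  by field; rewrite gt_eqF.
by rewrite -E; ring.
Qed.

Lemma goncarov_law_mean N :
  \sum_(n < N.+2) goncarov_law N.+1 n * (N.+1 - n)%:R / q n = N.+1%:R.
Proof.
under eq_bigr do rewrite goncarov_law_lower.
rewrite -mulr_sumr big_ord_recr /= goncarov_law_sum.
by rewrite /goncarov_law (bin_small (ltnSn N)) !mul0r addr0 mulr1.
Qed.

(** Lowering once and twice gives the first moment and the factorial second moment of the ratio. The
    gap between factorial and ordinary second moments carries one extra [1 / q n], replaced by [K];
    this costs [K / M] and leaves [1 / M] to spare. *)
Lemma goncarov_law_variance N :
  \sum_(n < N.+3) goncarov_law N.+2 n
     * ((N.+2 - n)%:R / N.+2%:R / q n - 1) ^+ 2 <= K / N.+2%:R.
Proof.
set M : R := N.+2%:R.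
have M0 : 0 < M by rewrite ltr0n.
have fact2 : \sum_(n < N.+3) goncarov_law N.+2 n * (N.+2 - n)%:R
     * (N.+1 - n)%:R / q n ^+ 2 = M * (M - 1).
  transitivity (\sum_(n < N.+3) M * (goncarov_law N.+1 n * (N.+1 - n)%:R / q n)).
    apply: eq_bigr => n _; have := goncarov_law_lower N.+1 n.
    by rewrite -/M => E; rewrite mulrA mulrA -E expr2 invfM; ring.
  rewrite -mulr_sumr big_ord_recr /= goncarov_law_mean.
  rewrite /goncarov_law (bin_small (ltnSn N.+1)) !mul0r addr0.
  by rewrite /M -[N.+2%:R]natr1 addrK.
have mean := goncarov_law_mean N.+1; rewrite -/M in mean.
have tot := goncarov_law_sum N.+2.
have step (n : 'I_N.+3) : goncarov_law N.+2 n * ((N.+2 - n)%:R / M / q n - 1) ^+ 2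
  <= M^-2 * (goncarov_law N.+2 n * (N.+2 - n)%:R * (N.+1 - n)%:R / q n ^+ 2)
   + (K / M ^+ 2 - 2 / M) * (goncarov_law N.+2 n * (N.+2 - n)%:R / q n)
   + goncarov_law N.+2 n.
  set p := goncarov_law _ _; set d : R := (N.+2 - n)%:R.
  have p0 : 0 <= p := goncarov_law_ge0 _ _.
  (* The truncated difference is [d - 1] except when [d = 0], where both sides vanish. *)
  have dd : d * (N.+1 - n)%:R = d * (d - 1).
    rewrite /d; have [nN|nN] := leqP n N.+1; first by rewrite subSn // -[_.+1%:R]natr1 addrK.
    by rewrite (eqP (_ : N.+2 - n == 0)%N) ?subn_eq0 // mulr0n !mul0r.
  have -> : p * d * (N.+1 - n)%:R = p * (d * (d - 1)) by rewrite -dd mulrA.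
  have : 0 <= p * d / M ^+ 2 / q n * (K - (q n)^-1).
    have d0 : 0 <= d by rewrite ler0n.
    have qn0 : 0 <= q n by rewrite ltW.
    by rewrite mulr_ge0 ?subr_ge0 // !divr_ge0 ?sqr_ge0 // mulr_ge0.
  rewrite -subr_ge0 => H; rewrite -subr_ge0; apply: le_trans H _.
  rewrite subr0 le_eqVlt; apply/orP; left; apply/eqP.
  by field; rewrite !gt_eqF.
apply: le_trans (ler_sum _ (fun i _ => step i)) _.
rewrite !big_split /= -!mulr_sumr fact2 mean tot.
rewrite -subr_ge0 (_ : _ - _ = M^-1); first by rewrite invr_ge0 ltW.
by field; rewrite gt_eqF.
Qed.

End GoncarovLaw.

(** * The exact law of the number of identifiable vertices *)

Lemma sum_subsets_card (V : nmodType) N (T : {set 'I_N}) (f : nat -> V) :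
  \sum_(B : {set 'I_N} | B \subset T) f #|B| =
  \sum_(j < N.+1) f j *+ 'C(#|T|, j).
Proof.
have cardN (B : {set 'I_N}) : (#|B| < N.+1)%N.
  by rewrite ltnS -[X in (_ <= X)%N]card_ord max_card.
rewrite (partition_big (fun B : {set 'I_N} => Ordinal (cardN B)) predT) //=.
apply: eq_bigr => j _.
rewrite (eq_bigr (fun=> f j)) => [|B /andP[_ /eqP <-] //].
rewrite sumr_const; congr (_ *+ _); rewrite -cards_draws -cardsE.
by apply: eq_card => B; rewrite !inE.
Qed.

(** A boundary set is [v |: B] for a unique [v] in [S :\: T] and a unique [B] inside [T]. *)
Lemma sum_boundary_card (R : comPzRingType) N (S T : {set 'I_N}) (f : nat -> R) :
  T \subset S ->
  \sum_(A : {set 'I_N} | boundary T S A) f #|A| =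
  #|S :\: T|%:R * \sum_(j < N.+1) 'C(#|T|, j)%:R * f j.+1.
Proof.
move=> TS; transitivity (\sum_(A : {set 'I_N} | boundary T S A) \sum_(v in A :\: T) f #|A|).
  by apply: eq_bigr => A /andP[_ /eqP A1]; rewrite sumr_const A1.
rewrite (exchange_big_dep (mem (S :\: T))) /=; last first.
  move=> A v /andP[AS _]; rewrite !inE => /andP[-> vA] /=.
  exact: (fintype.subsetP AS).
rewrite mulr_natl -sumr_const; apply: eq_bigr => v; rewrite inE => /andP[vT vS].
under [RHS]eq_bigr do rewrite mulr_natl.
rewrite -(sum_subsets_card T (fun n => f n.+1)).
rewrite (reindex_onto (fun B => v |: B) (fun A => A :\ v)) /=; last first.
  by move=> A /andP[_]; rewrite inE => /andP[_ vA]; rewrite finset.setD1K.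
apply: eq_big => [B|B /andP[_ /eqP BE]]; last first.
  by rewrite cardsU1 -{1}BE !inE eqxx.
rewrite !inE eqxx vT /= andbT.
apply/idP/idP => [/andP[/andP[_ B1] /eqP BE]|BT].
  have vB : v \notin B by rewrite -BE !inE eqxx.
  apply/fintype.subsetP => w wB; apply: contraT => wT.
  case/cards1P: B1 => u uE.
  have /set1P vu : v \in finset.set1 u by rewrite -uE !inE eqxx vT.
  have /set1P wu : w \in finset.set1 u by rewrite -uE !inE wB wT orbT.
  by rewrite vu -wu wB in vB.
have vB : v \notin B by apply: contra vT; apply: (fintype.subsetP BT).
rewrite finset.setU1K // eqxx andbT /boundary finset.subUset finset.sub1set vS /=.
rewrite (fintype.subset_trans BT TS) /=; apply/cards1P; exists v.
apply/finset.setP => w; rewrite !inE; have [->|wv] := eqVneq w v; first by rewrite vT.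
by rewrite /=; apply/negP => /andP[/negP wT /(fintype.subsetP BT)].
Qed.

Definition size_rate {R : realType} (beta : nat -> R) N k : R :=
  if k == 0%N then 0 else N%:R * beta k / 'C(N, k)%:R.

(** The total rate of the hyperedges that are patches at a given vertex once [n] other vertices are
    removed: that vertex together with [j] of the [n]. *)
Definition patch_rate {R : realType} (beta : nat -> R) N n : R :=
  \sum_(j < N.+1) 'C(n, j)%:R * size_rate beta N j.+1.

Section CardIdentifiable.
Variables (R : realType) (beta : nat -> R) (N : nat).
Hypothesis beta_ge0 : forall k, (1 <= k)%N -> 0 <= beta k.
Implicit Types (L : hypergraph N) (A B S T : {set 'I_N}).

Local Notation EE := (@hyper_expect R beta N).

Lemma size_rate_ge0 k : 0 <= size_rate beta N k.
Proof.
rewrite /size_rate; case: eqP => // /eqP; rewrite -lt0n => k0.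
by rewrite divr_ge0 // mulr_ge0 // beta_ge0.
Qed.

Lemma hyper_rate_ge0 A : 0 <= hyper_rate beta A.
Proof. exact: size_rate_ge0. Qed.

Lemma patch_rate_ge0 n : 0 <= patch_rate beta N n.
Proof. by apply: sumr_ge0 => j _; rewrite mulr_ge0 // size_rate_ge0. Qed.

Lemma le_patch_rate m n : (m <= n)%N -> patch_rate beta N m <= patch_rate beta N n.
Proof.
move=> mn; apply: ler_sum => j _; rewrite ler_wpM2r ?size_rate_ge0 //.
by rewrite ler_nat leq_bin2l.
Qed.

Definition no_patch_prob n : R := expR (- patch_rate beta N n).
Local Notation q := no_patch_prob.
Local Notation fill S := (EE (fun L => (identifiable (restrict L S) == S)%:R)).

Lemma hyper_expect_restrict_eq S T : T \subset S ->
  EE (fun L => (identifiable (restrict L S) == T)%:R) =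
  ((q #|T| ^+ #|S :\: T|)%:E * fill T)%E.
Proof.
move=> TS; pose s := enum [pred A | boundary T S A].
have qE : q #|T| ^+ #|S :\: T| = expR (- \sum_(A <- s) hyper_rate beta A).
  rewrite /s big_enum /= (sum_boundary_card (size_rate beta N) TS).
  by rewrite -mulrN expRM_natl.
rewrite qE -hyper_expect_vanish ?enum_uniq //.
- apply: eq_hyper_expect => L; rewrite identifiable_restrict_eq //.
  rewrite -mulnb natrM; congr (_ * _%:R); congr nat_of_bool.
  apply/forall_inP/allP => H A; first by rewrite mem_enum => /H.
  by move=> bA; apply: H; rewrite mem_enum.
- exact: hyper_rate_ge0.
(* A boundary set is not contained in [T], so a hyperedge there is invisible to [restrict L T]. *)
- move=> A L; rewrite mem_enum => /andP[_ A1]; congr (_%:R).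
  have -> : restrict (add_edge L A) T = restrict L T; last by [].
  apply/ffunP => B; rewrite !ffunE; case: ifP => // BT.
  case: eqP => [BA|]; last by rewrite addn0.
  by move: A1; rewrite -BA; move: BT; rewrite -finset.setD_eq0 => /eqP ->; rewrite cards0.
Qed.

Lemma fill_partition S :
  (\sum_(T : {set 'I_N} | T \subset S) (q #|T| ^+ #|S :\: T|)%:E * fill T = 1)%E.
Proof.
under eq_bigr => T TS do rewrite -hyper_expect_restrict_eq //.
rewrite -hyper_expect_sum; [|exact: hyper_rate_ge0|by []].
rewrite -(hyper_expect1 hyper_rate_ge0); apply: eq_hyper_expect => L.
rewrite (bigD1 (identifiable (restrict L S))) ?identifiable_restrict_sub //= eqxx.
by rewrite big1 ?addr0 // => T /andP[_ /negPf]; rewrite eq_sym => ->.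
Qed.

(** The filling probabilities and the values [(goncarov q n).[1]] solve the same triangular system
    ([fill_partition], [goncarov1_sum]), whose diagonal coefficient is 1. *)
Lemma fill_probE S : fill S = ((goncarov q #|S|).[1])%:E.
Proof.
have [n nS] := ubnP #|S|; elim: n S nS => // n IH S nS.
pose g k := (goncarov q k).[1].
pose x := \sum_(T : {set 'I_N} | (T \subset S) && (T != S)) q #|T| ^+ (#|S| - #|T|) * g #|T|.
have gE : g #|S| + x = 1.
  rewrite -(goncarov1_sum q #|S|).
  transitivity (\sum_(T : {set 'I_N} | T \subset S) q #|T| ^+ (#|S| - #|T|) * g #|T|).
    by rewrite [RHS](bigD1 S) //= subnn expr0 mul1r.
  rewrite (sum_subsets_card S (fun k => q k ^+ (#|S| - k) * g k)).
  have SN : (#|S|.+1 <= N.+1)%N by rewrite ltnS -[X in (_ <= X)%N]card_ord max_card.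
  rewrite [RHS](big_ord_widen N.+1 (fun i => 'C(#|S|, i)%:R * g i * q i ^+ (#|S| - i)) SN).
  rewrite [RHS]big_mkcond /=; apply: eq_bigr => i _; rewrite ltnS.
  case: leqP => [_|iS]; last by rewrite bin_small // mulr0n.
  by rewrite -[LHS]mulr_natl [q _ ^+ _ * _]mulrC mulrA.
have := fill_partition S.
rewrite (bigD1 S) //= finset.setDv cards0 expr0 mul1e.
have -> : (\sum_(T : {set 'I_N} | (T \subset S) && (T != S))
    (q #|T| ^+ #|S :\: T|)%:E * fill T = x%:E)%E.
  rewrite -sumEFin; apply: eq_bigr => T /andP[TS TnS]; rewrite IH; last first.
    apply: (@leq_trans #|S|); last by rewrite -ltnS.
    by apply: proper_card; rewrite finset.properEneq TnS.
  by rewrite -EFinM cardsDS.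
rewrite -/(g #|S|); case: (fill S) => [r||] //= [rE].
by congr (_%:E); apply: (addIr x); rewrite gE.
Qed.

Lemma card_identifiable_prob n :
  EE (fun L => (#|identifiable L| == n)%:R) = (goncarov_law q N n)%:E.
Proof.
transitivity (\sum_(T : {set 'I_N} | #|T| == n) EE (fun L => (identifiable L == T)%:R))%E.
  rewrite -hyper_expect_sum; [|exact: hyper_rate_ge0|by []].
  apply: eq_hyper_expect => L; case: eqP => [Ln|Ln].
    rewrite (bigD1 (identifiable L)) /= ?Ln // eqxx.
    by rewrite big1 ?addr0 // => T /andP[_ /negPf]; rewrite eq_sym => ->.
  by rewrite big1 // => T /eqP Tn; case: eqP => // LT; rewrite LT in Ln.
transitivity (\sum_(T : {set 'I_N} | #|T| == n) (q n ^+ (N - n) * (goncarov q n).[1])%:E)%E.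
  apply: eq_bigr => T /eqP Tn.
  have := hyper_expect_restrict_eq (finset.subsetT T).
  rewrite fill_probE -EFinM cardsDS ?finset.subsetT // cardsT card_ord Tn => <-.
  by apply: eq_hyper_expect => L; rewrite restrict_setT.
rewrite sumEFin sumr_const; congr (_%:E).
have -> : #|[pred T : {set 'I_N} | #|T| == n]| = 'C(N, n).
  by rewrite -[N in RHS]card_ord -card_draws; apply: eq_card => T; rewrite !inE.
by rewrite -[LHS]mulr_natl /goncarov_law mulrA mulrAC.
Qed.

Lemma hyper_expect_card_identifiable (u : nat -> R) : (forall n, 0 <= u n) ->
  EE (fun L => u #|identifiable L|) =
  (\sum_(n < N.+1) u n * goncarov_law q N n)%:E.
Proof.
move=> u0; rewrite -sumEFin.
transitivity (\sum_(n < N.+1) EE (fun L => u n * (#|identifiable L| == n)%:R)%R)%E.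
  rewrite -hyper_expect_sum; last 2 first.
  - exact: hyper_rate_ge0.
  - by move=> n L _; rewrite mulr_ge0.
  apply: eq_hyper_expect => L.
  have cardN : (#|identifiable L| < N.+1)%N by rewrite ltnS -[X in (_ <= X)%N]card_ord max_card.
  rewrite (bigD1 (Ordinal cardN)) //= eqxx mulr1 big1 ?addr0 // => n.
  by rewrite -val_eqE /= eq_sym => /negPf ->; rewrite mulr0.
apply: eq_bigr => n _; rewrite hyper_expectZ ?card_identifiable_prob -?EFinM //.
exact: hyper_rate_ge0.
Qed.

End CardIdentifiable.

(** * Series dominated by the weights [k * beta k] *)

Section WeightedSum.
Variables (R : realType) (beta : nat -> R).
Hypothesis beta_ge0 : forall k, (1 <= k)%N -> 0 <= beta k.
Hypothesis beta_sum : cvgn (series (fun k => k%:R * beta k)).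
Implicit Types (a : nat -> R).

Definition degree_weight (j : nat) : R := j.+1%:R * beta j.+1.
Local Notation w := degree_weight.

(** Common form of [beta_deriv] (with [a j = t ^+ j]) and of [patch_rate] (with [a j] a ratio of
    binomials), so that one tail estimate compares them. *)
Definition weighted_sum a : R := limn (series (fun j => w j * a j)).

Definition total_weight : R := limn (series w).
Local Notation C := total_weight.

Definition unit_valued a := forall j, 0 <= a j <= 1.

Lemma degree_weight_ge0 j : 0 <= w j.
Proof. by rewrite mulr_ge0 // beta_ge0. Qed.

Lemma series_degree_weight n :
  series w n = series (fun k => k%:R * beta k) n.+1.
Proof. by rewrite /series /= big_nat_recl //= mul0r add0r. Qed.

Lemma is_cvg_series_degree_weight : cvgn (series w).
Proof.
case/cvg_ex: beta_sum => l lP; apply/cvg_ex; exists l.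
move: lP; rewrite -cvg_shiftS /=.
by under eq_fun do rewrite -series_degree_weight.
Qed.

Lemma nondecreasing_series_degree_weight :
  {homo series w : n m / (n <= m)%N >-> n <= m}.
Proof. by apply: nondecreasing_series => *; apply: degree_weight_ge0. Qed.

Lemma series_degree_weight_le n : series w n <= C.
Proof.
exact: nondecreasing_cvgn_le nondecreasing_series_degree_weight
  is_cvg_series_degree_weight n.
Qed.

Lemma total_weight_ge0 : 0 <= C.
Proof. by have := series_degree_weight_le 0; rewrite /series /= big_geq. Qed.

Lemma is_cvg_weighted_sum a : unit_valued a -> cvgn (series (fun j => w j * a j)).
Proof.
move=> a01; apply: (series_le_cvg (v_ := w)) is_cvg_series_degree_weight => n.
- by have /andP[a0 _] := a01 n; rewrite mulr_ge0 // degree_weight_ge0.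
- exact: degree_weight_ge0.
- by have /andP[_ a1] := a01 n; rewrite ler_piMr // degree_weight_ge0.
Qed.

Lemma weighted_sum_ge0 a : unit_valued a -> 0 <= weighted_sum a.
Proof.
move=> a01; apply: limr_ge; first exact: is_cvg_weighted_sum.
by near=> n; apply: sumr_ge0 => j _; have /andP[a0 _] := a01 j;
  rewrite mulr_ge0 // degree_weight_ge0.
Unshelve. all: by end_near. Qed.

Lemma weighted_sum_le a : unit_valued a -> weighted_sum a <= C.
Proof.
move=> a01; apply: limr_le; first exact: is_cvg_weighted_sum.
near=> n; apply: le_trans (series_degree_weight_le n); apply: ler_sum => j _.
by have /andP[_ a1] := a01 j; rewrite ler_piMr // degree_weight_ge0.
Unshelve. all: by end_near. Qed.

(** Beyond [J] the weights sum to at most [eps / 2], uniformly in the unit-valued coefficients;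
    below [J] it suffices that the coefficients be close. *)
Lemma weighted_sum_close (eps : R) : 0 < eps ->
  exists J : nat, exists2 d : R, 0 < d &
  forall a a', unit_valued a -> unit_valued a' ->
    (forall j, (j < J)%N -> `|a j - a' j| <= d) ->
    `|weighted_sum a - weighted_sum a'| <= eps.
Proof.
move=> eps0.
have [J _ JP] : \forall n \near \oo, `|C - series w n| <= eps / 2.
  by move/cvgrPdist_le: is_cvg_series_degree_weight; apply; rewrite divr_gt0.
have C0 := total_weight_ge0.
exists J, (eps / 2 / (C + 1)); first by rewrite !divr_gt0 // ltr_wpDl.
move=> a a' a01 a'01 aa'.
have ca := is_cvg_weighted_sum a01; have ca' := is_cvg_weighted_sum a'01.
have cB := is_cvgB ca ca'.
rewrite /weighted_sum -limB // -lim_norm //; last exact: cB.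
apply: limr_le.
  exact: is_cvg_norm (cB _).
near=> n; have Jn : (J <= n)%N by near: n; exists J.
set u := (X in `|X|).
have -> : u = \sum_(0 <= j < n) w j * (a j - a' j).
  rewrite /u [LHS](_ : _ = series (fun j => w j * a j) n - series (fun j => w j * a' j) n) //.
  by rewrite /series /= -sumrB; apply: eq_bigr => j _; rewrite mulrBr.
apply: le_trans (ler_norm_sum _ _ _) _.
rewrite (big_cat_nat (leq0n J) Jn) /=.
rewrite [eps](splitr eps); apply: lerD.
  apply: (@le_trans _ _ (\sum_(0 <= j < J) w j * (eps / 2 / (C + 1)))).
    rewrite big_nat_cond [leRHS]big_nat_cond; apply: ler_sum => j /andP[/andP[_ jJ] _].
    by rewrite normrM ger0_norm ?degree_weight_ge0 // ler_wpM2l ?degree_weight_ge0 ?aa'.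
  rewrite -mulr_suml mulrCA ler_piMr ?divr_ge0 ?(ltW eps0) //.
  rewrite ler_pdivrMr ?mul1r ?ltr_wpDl //.
  by apply: le_trans (series_degree_weight_le J) _; rewrite lerDl.
apply: (@le_trans _ _ (\sum_(J <= j < n) w j)).
  apply: ler_sum => j _; rewrite normrM ger0_norm ?degree_weight_ge0 //.
  rewrite ler_piMr ?degree_weight_ge0 //.
  by have /andP[? ?] := a01 j; have /andP[? ?] := a'01 j; rewrite ler_norml; lra.
apply: le_trans (JP J (leqnn J)); apply: le_trans (ler_norm _).
rewrite lerBrDl; apply: le_trans (series_degree_weight_le n).
by rewrite /series /= (big_cat_nat (leq0n J) Jn).
Unshelve. all: by end_near. Qed.

End WeightedSum.

(** * Elementary distance estimates *)

Lemma expR_dist_le (R : realType) (x y c : R) : x <= c -> y <= c ->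
  `|expR x - expR y| <= expR c * `|x - y|.
Proof.
wlog xy : x y / x <= y.
  move=> H xc yc; have [xy|/ltW yx] := leP x y; first exact: H.
  by rewrite distrC [`|x - y|]distrC; apply: H.
move=> xc yc; rewrite distrC [`|x - y|]distrC !ger0_norm ?subr_ge0 ?ler_expR //.
apply: (@le_trans _ _ (expR y * (y - x))); last first.
  by rewrite ler_wpM2r ?subr_ge0 ?ler_expR.
have := expR_ge1Dx (x - y); rewrite expRB ler_pdivlMr ?expR_gt0 //; lra.
Qed.

Lemma exprn_dist_le (R : realType) (x y : R) j : 0 <= x <= 1 -> 0 <= y <= 1 ->
  `|x ^+ j - y ^+ j| <= j%:R * `|x - y|.
Proof.
move=> /andP[x0 x1] /andP[y0 y1]; elim: j => [|j IH].
  by rewrite !expr0 subrr normr0 mul0r.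
have -> : x ^+ j.+1 - y ^+ j.+1 = x * (x ^+ j - y ^+ j) + (x - y) * y ^+ j.
  by rewrite !exprS; ring.
apply: le_trans (ler_normD _ _) _; rewrite !normrM -natr1 mulrDl mul1r.
rewrite (ger0_norm x0) [`|y ^+ j|]ger0_norm ?exprn_ge0 //.
apply: lerD; first by apply: le_trans IH; rewrite ler_piMl.
by rewrite ler_piMr // exprn_ile1.
Qed.

Lemma bin_ratio_unit (R : realType) n M : (n <= M)%N ->
  unit_valued (fun j => 'C(n, j)%:R / 'C(M, j)%:R : R).
Proof.
move=> nM j; rewrite divr_ge0 //=; have [jM|Mj] := leqP j M.
  by rewrite ler_pdivrMr ?ltr0n ?bin_gt0 // mul1r ler_nat leq_bin2l.
(* For [j > M] the quotient is 0 by the convention [0^-1 = 0]. *)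
by rewrite (bin_small Mj) invr0 mulr0.
Qed.

Lemma expr_unit (R : realType) (t : R) : 0 <= t <= 1 -> unit_valued (fun j => t ^+ j).
Proof. by move=> /andP[t0 t1] j; rewrite exprn_ge0 //= exprn_ile1. Qed.

(** The ratio of binomials is the product of the [(n - i) / (M - i)] for [i < j], each close to
    [n / (M + 1)]. The shift is there because [M] stands for [N - 1], the number of other
    vertices. *)
Lemma bin_ratio_dist_le (R : realType) n M J j : (n <= M)%N -> (j <= J)%N -> (J < M)%N ->
  `|'C(n, j)%:R / 'C(M, j)%:R - (n%:R / M.+1%:R) ^+ j|
  <= j%:R * (J.+1%:R / (M - J)%:R) :> R.
Proof.
move=> nM jJ JM; have nM1 : (n%:R / M.+1%:R : R) <= 1.
  by rewrite ler_pdivrMr ?ltr0n // mul1r ler_nat leqW.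
have n0 : (0 : R) <= n%:R / M.+1%:R by rewrite divr_ge0.
elim: j jJ => [_|j IH jJ]; first by rewrite !bin0 expr0 divr1 subrr normr0 mul0r.
have jM : (j < M)%N by lia.
set y := n%:R / M.+1%:R in n0 nM1 IH *.
pose r : R := (n - j)%:R / (M - j)%:R.
have Mj0 : (0 : R) < (M - j)%:R by rewrite ltr0n subn_gt0.
have r01 : 0 <= r <= 1.
  by rewrite divr_ge0 //= ler_pdivrMr // mul1r ler_nat leq_sub2r.
have ratioS : 'C(n, j.+1)%:R / 'C(M, j.+1)%:R = 'C(n, j)%:R / 'C(M, j)%:R * r.
  have E k : (j.+1%:R * 'C(k, j.+1)%:R = (k - j)%:R * 'C(k, j)%:R :> R).
    by rewrite -!natrM mul_bin_left.
  have j1 : j.+1%:R != 0 :> R by rewrite pnatr_eq0.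
  have E' k : 'C(k, j.+1)%:R = j.+1%:R^-1 * ((k - j)%:R * 'C(k, j)%:R) :> R.
    by rewrite -E mulrA mulVf // mul1r.
  have : 'C(M, j)%:R != 0 :> R by rewrite pnatr_eq0 -lt0n bin_gt0 ltnW.
  by move: j1 (gt_eqF Mj0) => j1 /negbT Mj b0; rewrite !E' /r; field; rewrite ?nat1r j1 Mj b0.
have ry : `|r - y| <= J.+1%:R / (M - J)%:R.
  apply: (@le_trans _ _ (j.+1%:R / (M - j)%:R)); last first.
    apply: ler_pM => //; first by rewrite ler_nat ltnS ltnW.
    by rewrite lef_pV2 ?posrE ?ltr0n ?subn_gt0 // ler_nat leq_sub2l // ltnW.
  have M10 : (0 : R) < M.+1%:R by rewrite ltr0n.
  have [jn|nj] := leqP j n; last first.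
    rewrite /r (eqP (_ : n - j == 0)%N) ?subn_eq0 ?(ltnW nj) //.
    rewrite mul0r sub0r normrN ger0_norm // /y.
    rewrite ler_pdivrMr // mulrAC ler_pdivlMr // -!natrM ler_nat.
    by apply: leq_mul; lia.
  rewrite /r /y natrB // natrB ?(ltnW jM) //.
  have -> : (n%:R - j%:R) / (M%:R - j%:R) - n%:R / M.+1%:R =
     (n%:R * (j%:R + 1) - M.+1%:R * j%:R) / M.+1%:R / (M%:R - j%:R) :> R.
    have := gt_eqF Mj0; rewrite natrB ?(ltnW jM) // => /negbT Mj.
    rewrite -natr1; field; rewrite ?natr1.
    by rewrite Mj pnatr_eq0.
  rewrite !normrM normfV [`|_^-1|]ger0_norm; last first.
    by rewrite invr_ge0 -natrB ?(ltnW jM) // ltW.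
  rewrite ler_wpM2r ?invr_ge0 -?natrB ?(ltnW jM) ?ler0n //.
  rewrite [`|M.+1%:R|]ger0_norm // ler_pdivrMr //.
  have nM' : n%:R <= M.+1%:R :> R by rewrite ler_nat leqW.
  have j0 : (0 : R) <= j%:R by [].
  have n0' : (0 : R) <= n%:R by [].
  by rewrite ler_norml -natr1; nra.
clearbody r y; have /andP[r0 r1] := r01.
have -> : 'C(n, j.+1)%:R / 'C(M, j.+1)%:R - y ^+ j.+1 =
    ('C(n, j)%:R / 'C(M, j)%:R - y ^+ j) * r + y ^+ j * (r - y).
  by rewrite ratioS exprSr; ring.
apply: le_trans (ler_normD _ _) _; rewrite !normrM -natr1 mulrDl mul1r.
rewrite (ger0_norm r0) [`|y ^+ j|]ger0_norm ?exprn_ge0 //; apply: lerD.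
  by apply: le_trans (IH (ltnW jJ)); rewrite ler_piMr.
by apply: le_trans ry; rewrite ler_piMl // exprn_ile1.
Qed.

(** * Comparison of the patch rates with the derivative of the generating function *)

Section RateLimits.
Variables (R : realType) (beta : nat -> R).
Hypothesis beta_ge0 : forall k, (1 <= k)%N -> 0 <= beta k.
Hypothesis beta_sum : cvgn (series (fun k => k%:R * beta k)).

Local Notation C := (total_weight beta).

Lemma beta_derivE (t : R) : 0 <= t <= 1 ->
  beta_deriv beta t = weighted_sum beta (fun j => t ^+ j).
Proof.
move=> t01; apply: cvg_lim => //; rewrite -cvg_shiftS /=.
have E : series (fun j => degree_weight beta j * t ^+ j)
    = (fun n => \sum_(1 <= k < n.+1) k%:R * beta k * t ^+ k.-1).
  by apply/funext => n; rewrite /series /= big_add1.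
have := is_cvg_weighted_sum beta_ge0 beta_sum (expr_unit t01).
by rewrite /weighted_sum E.
Qed.

(** By [(M + 1) 'C(M, j) = (j + 1) 'C(M + 1, j + 1)] the rate of one set of size [j + 1] is the
    weight of index [j] over ['C(M, j)]. The series is eventually constant because ['C(n, j)]
    vanishes for large [j]. *)
Lemma patch_rateE M n : (n <= M)%N ->
  patch_rate beta M.+1 n = weighted_sum beta (fun j => 'C(n, j)%:R / 'C(M, j)%:R).
Proof.
move=> nM; apply/esym; apply: lim_near_cst => //; near=> m.
have mM : (M.+2 <= m)%N by near: m; exists M.+2.
rewrite /series /= (big_cat_nat (leq0n M.+2) mM) /=.
rewrite [X in _ + X = _]big_nat_cond [X in _ + X = _]big1; last first.
  move=> j /andP[/andP[jM _] _].
  by rewrite bin_small ?mul0r ?mulr0 //; lia.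
rewrite addr0 big_mkord; apply: eq_bigr => -[j /= jM] _.
have [{}jM|Mj] := leqP j M; last by rewrite bin_small ?mul0r ?mulr0 //; lia.
rewrite /size_rate /= /degree_weight.
have := mul_bin_diag M.+1 j => /(congr1 (fun k => k%:R : R)); rewrite !natrM /= => E.
have b1 : 'C(M, j)%:R != 0 :> R by rewrite pnatr_eq0 -lt0n bin_gt0.
have b2 : 'C(M.+1, j.+1)%:R != 0 :> R by rewrite pnatr_eq0 -lt0n bin_gt0 ltnS.
have -> : j.+1%:R = M.+1%:R * 'C(M, j)%:R / 'C(M.+1, j.+1)%:R :> R.
  by rewrite E mulfK.
by field; rewrite b1 b2.
Unshelve. all: by end_near. Qed.

Lemma beta_deriv_ge0 t : 0 <= t <= 1 -> 0 <= beta_deriv beta t.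
Proof. by move=> t01; rewrite beta_derivE // weighted_sum_ge0 //; apply: expr_unit. Qed.

Lemma beta_deriv_le t : 0 <= t <= 1 -> beta_deriv beta t <= C.
Proof. by move=> t01; rewrite beta_derivE // weighted_sum_le //; apply: expr_unit. Qed.

Lemma patch_rate_le N n : (n < N)%N -> patch_rate beta N n <= C.
Proof.
case: N => // M nM; rewrite patch_rateE // weighted_sum_le //.
exact: bin_ratio_unit.
Qed.

Lemma beta_deriv_close (eps : R) : 0 < eps -> exists2 d : R, 0 < d &
  forall x y, 0 <= x <= 1 -> 0 <= y <= 1 -> `|x - y| <= d ->
  `|beta_deriv beta x - beta_deriv beta y| <= eps.
Proof.
move=> eps0; have [J [d d0 dP]] := weighted_sum_close beta_ge0 beta_sum eps0.
exists (d / J.+1%:R) => [|x y x01 y01 xy]; first by rewrite divr_gt0.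
rewrite !beta_derivE //; apply: dP; try exact: expr_unit.
move=> j jJ; apply: le_trans (exprn_dist_le _ x01 y01) _.
apply: (@le_trans _ _ (J.+1%:R * `|x - y|)).
  by rewrite ler_wpM2r // ler_nat ltnW // ltnW.
by rewrite mulrC -ler_pdivlMr.
Qed.

Lemma patch_rate_close (eps : R) : 0 < eps -> exists N0 : nat,
  forall N n, (N0 <= N)%N -> (n < N)%N ->
  `|patch_rate beta N n - beta_deriv beta (n%:R / N%:R)| <= eps.
Proof.
move=> eps0; have [J [d d0 dP]] := weighted_sum_close beta_ge0 beta_sum eps0.
(* For [j < J] the binomial error is at most [c / (M - J)], so [M - J] must exceed [c / d]. *)
pose c : R := J%:R * J.+1%:R.
pose N1 := Num.truncn (c / d).
have N1P : c / d < N1.+1%:R by rewrite truncnS_gt.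
exists (J + N1).+3 => -[//|M] n NM nM.
have nM01 : 0 <= (n%:R / M.+1%:R : R) <= 1.
  rewrite divr_ge0 //= ler_pdivrMr ?ltr0n // mul1r ler_nat; exact: ltnW.
rewrite patch_rateE // beta_derivE //; apply: dP.
- exact: bin_ratio_unit.
- exact: expr_unit.
move=> j jJ; have JM : (J < M)%N by lia.
apply: le_trans (bin_ratio_dist_le _ _ (ltnW jJ) JM) _ => //.
have MJ : (0 : R) < (M - J)%:R by rewrite ltr0n subn_gt0; lia.
apply: (@le_trans _ _ (c / (M - J)%:R)).
  rewrite /c -mulrA ler_wpM2r ?divr_ge0 // ler_nat ltnW //.
rewrite ler_pdivrMr // mulrC -ler_pdivrMr //; apply: le_trans (ltW N1P) _.
by rewrite ler_nat; lia.
Qed.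

(* [beta'(t) + log (1 - t) < 0] iff [survival_ratio t < 1]; unlike the former,
   the latter is uniformly continuous on the whole of [0, 1]. *)
Definition survival_ratio (t : R) : R := (1 - t) * expR (beta_deriv beta t).

Lemma scaled_expR_dist_le (u v x y c : R) : 0 <= u <= 1 -> x <= c -> y <= c ->
  `|u * expR x - v * expR y| <= expR c * (`|x - y| + `|u - v|).
Proof.
move=> /andP[u0 u1] xc yc.
have -> : u * expR x - v * expR y = u * (expR x - expR y) + (u - v) * expR y by ring.
apply: le_trans (ler_normD _ _) _; rewrite !normrM mulrDr; apply: lerD.
  apply: le_trans (expR_dist_le xc yc); rewrite ger0_norm // ler_piMl //.
rewrite mulrC ler_wpM2r // ger0_norm ?expR_ge0 // ler_expR //.
Qed.

Lemma survival_ratio_close (eps : R) : 0 < eps -> exists2 d : R, 0 < d &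
  forall x y, 0 <= x <= 1 -> 0 <= y <= 1 -> `|x - y| <= d ->
  `|survival_ratio x - survival_ratio y| <= eps.
Proof.
move=> eps0; have e0 : 0 < eps / 2 / expR C by rewrite !divr_gt0 ?expR_gt0.
have [d d0 dP] := beta_deriv_close e0.
exists (Num.min d (eps / 2 / expR C)) => [|x y x01 y01].
  by rewrite lt_min d0.
rewrite le_min => /andP[xyd xye].
have x01' : 0 <= 1 - x <= 1 by move/andP: x01 => [? ?]; apply/andP; split; lra.
have := scaled_expR_dist_le (1 - y) x01' (beta_deriv_le x01) (beta_deriv_le y01).
move=> /le_trans; apply.
have -> : 1 - x - (1 - y) = - (x - y) by ring.
rewrite normrN mulrC -ler_pdivlMr ?expR_gt0 //.
rewrite [eps](splitr eps) mulrDl; apply: lerD => //; exact: dP.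
Qed.

Lemma patch_survival_close (eps : R) : 0 < eps -> exists N0 : nat,
  forall N n, (N0 <= N)%N -> (n <= N)%N ->
  `|(N - n)%:R / N%:R * expR (patch_rate beta N n) - survival_ratio (n%:R / N%:R)| <= eps.
Proof.
move=> eps0; have e0 : 0 < eps / expR C by rewrite !divr_gt0 ?expR_gt0.
have [N0 N0P] := patch_rate_close e0; exists N0.+1 => N n NN nN.
have N1 : (0 : R) < N%:R by rewrite ltr0n; lia.
have uE : (N - n)%:R / N%:R = 1 - n%:R / N%:R :> R.
  by rewrite natrB // mulrBl divff // gt_eqF.
move: nN; rewrite leq_eqVlt => /predU1P[->|nN].
  by rewrite subnn mul0r mul0r /survival_ratio divff ?gt_eqF // subrr mul0r subr0 normr0 ltW.
have nN01 : 0 <= (n%:R / N%:R : R) <= 1.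
  by rewrite divr_ge0 //= ler_pdivrMr // mul1r ler_nat ltnW.
have x01' : 0 <= (1 - n%:R / N%:R : R) <= 1 by move/andP: nN01 => [? ?]; apply/andP; split; lra.
rewrite uE.
have := scaled_expR_dist_le (1 - n%:R / N%:R) x01' (patch_rate_le nN) (beta_deriv_le nN01).
move=> /le_trans; apply.
rewrite subrr normr0 addr0 mulrC -ler_pdivlMr ?expR_gt0 //; apply: N0P => //; exact: ltnW.
Qed.

End RateLimits.

(** * The survival ratio around the threshold *)

Section Threshold.
Variables (R : realType) (beta : nat -> R).
Hypothesis beta_ge0 : forall k, (1 <= k)%N -> 0 <= beta k.
Hypothesis beta_sum : cvgn (series (fun k => k%:R * beta k)).

Local Notation C := (total_weight beta).
Local Notation g := (survival_ratio beta).
Local Notation ts := (tstar beta).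
Local Notation subcritical :=
  [set t : R | 0 <= t /\ t < 1 /\ beta_deriv beta t + ln (1 - t) < 0].

Lemma survival_ratioE (t : R) : t < 1 -> g t = expR (beta_deriv beta t + ln (1 - t)).
Proof.
by move=> t1; rewrite expRD lnK ?posrE ?subr_gt0 // mulrC.
Qed.

Lemma subcritical_neq0 : subcritical !=set0.
Proof.
have e0 := expR_gt0 (- (C + 1)).
have e1 : expR (- (C + 1)) <= 1.
  by rewrite expR_le1 oppr_le0 addr_ge0 // total_weight_ge0.
(* Here [ln (1 - t) = - (C + 1)], while [beta_deriv] is at most [C]. *)
exists (1 - expR (- (C + 1))); split; first by rewrite subr_ge0.
split; first by rewrite ltrBlDl ltrDr.
rewrite subKr expRK.
have t01 : 0 <= 1 - expR (- (C + 1)) <= 1 by apply/andP; split; lra.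
have := beta_deriv_le beta_ge0 beta_sum t01; lra.
Qed.

Lemma has_inf_subcritical : has_inf subcritical.
Proof. by split; [exact: subcritical_neq0|exists 0 => t [] ]. Qed.

Lemma tstar_ge0 : 0 <= ts.
Proof. by apply: lb_le_inf; [exact: subcritical_neq0|move=> t []]. Qed.

Lemma subcritical_near (d : R) : 0 < d ->
  exists s, [/\ ts <= s, s <= ts + d, s < 1 & g s < 1].
Proof.
move=> d0; have [s [s0 [s1 sneg]] sd] := inf_adherent d0 has_inf_subcritical.
exists s; split => //; last by rewrite survival_ratioE // expR_lt1.
- by apply: ge_inf => //; case: has_inf_subcritical.
- exact: ltW.
Qed.

Lemma tstar_lt1 : ts < 1.
Proof.
by have [s [tss _ s1 _]] := subcritical_near (ltr01 : 0 < 1 :> R); apply: le_lt_trans s1.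
Qed.

Lemma tstar01 : 0 <= ts <= 1.
Proof. by rewrite tstar_ge0 ltW // tstar_lt1. Qed.

Hypothesis no_zero : forall t : R, 0 <= t -> t < ts ->
  beta_deriv beta t + ln (1 - t) != 0.

Lemma survival_ratio_gt1 t : 0 <= t -> t < ts -> 1 < g t.
Proof.
move=> t0 tts; have t1 := lt_trans tts tstar_lt1.
rewrite survival_ratioE // expR_gt1 lt_neqAle eq_sym no_zero //= leNgt.
apply/negP => neg; have : ts <= t by apply: ge_inf; [case: has_inf_subcritical|split].
by rewrite leNgt tts.
Qed.

(** By continuity: at most 1 from subcritical points arbitrarily close above, at least 1 from the
    points below. *)
Lemma survival_ratio_tstar : g ts = 1.
Proof.
have ts0 := tstar_ge0; have ts1 := tstar_lt1.
apply/eqP; rewrite eq_le; apply/andP; split; apply/ler_addgt0Pr => e e0.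
  have [d d0 dP] := survival_ratio_close beta_ge0 beta_sum e0.
  have [s [tss sd s1 gs]] := subcritical_near d0.
  have s01 : 0 <= s <= 1 by apply/andP; split; lra.
  have := dP ts s tstar01 s01.
  rewrite distrC ger0_norm ?subr_ge0 // lerBlDl => /(_ sd).
  by rewrite ler_norml; lra.
(* With [ts = 0] there is nothing below, but then [g 0] is the exponential of a nonnegative
   number. *)
have [ts_eq0|ts_neq0] := eqVneq ts 0.
  apply: (@le_trans _ _ (g ts)); last by rewrite lerDl ltW.
  rewrite survival_ratioE // -[leLHS]expR0 ler_expR ts_eq0 subr0 ln1 addr0.
  by rewrite beta_deriv_ge0 // lexx ler01.
have tspos : 0 < ts by rewrite lt0r ts_neq0.
have [d d0 dP] := survival_ratio_close beta_ge0 beta_sum e0.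
pose t := Num.max 0 (ts - d).
have t0 : 0 <= t by rewrite le_max lexx.
have tts : t < ts by rewrite gt_max tspos ltrBlDr ltrDl.
have t01 : 0 <= t <= 1 by apply/andP; split; lra.
have := dP t ts t01 tstar01; rewrite distrC ger0_norm ?subr_ge0 ?(ltW tts) //.
have : ts - t <= d by rewrite lerBlDr addrC -lerBlDr le_max lexx orbT.
move=> td /(_ td); have := survival_ratio_gt1 t0 tts.
by rewrite ler_norml; lra.
Qed.

Lemma beta_deriv_tstar : beta_deriv beta ts = - ln (1 - ts).
Proof.
have := survival_ratio_tstar; rewrite survival_ratioE ?tstar_lt1 // -expR0.
by move/expR_inj/eqP; rewrite addr_eq0 => /eqP.
Qed.

Lemma survival_ratio_lower (d : R) : 0 < d -> exists2 k : R, 0 < k &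
  forall t, 0 <= t -> t <= ts - d -> 1 + k <= g t.
Proof.
move=> d0; have [tsd|tsd] := ltP (ts - d) 0.
  by exists 1 => // t t0 td; lra.
(* Precomposing with the projection onto [[0, ts - d]] makes [g] continuous on the whole line; its
   minimum over the compact interval is attained and exceeds 1. *)
pose clamp (t : R) := Num.max 0 (Num.min t (ts - d)).
have ts1 := tstar_lt1.
have clamp01 t : 0 <= clamp t <= 1.
  rewrite /clamp le_max lexx /= ge_max ler01 /= ge_min; apply/orP; right; lra.
have clampK t : 0 <= t -> t <= ts - d -> clamp t = t.
  by move=> t0 td; rewrite /clamp (min_idPl td) (max_idPr t0).
have clamp_lip x y : `|clamp x - clamp y| <= `|x - y|.
  rewrite /clamp; have a := ler_norm (x - y); have b := ler_norm (- (x - y)).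
  rewrite normrN in b.
  case: (leP x (ts - d)) => ?; case: (leP y (ts - d)) => ?;
  case: (leP 0 x) => ?; case: (leP 0 y) => ?;
  rewrite ?(max_idPr tsd) ler_norml; apply/andP; split; lra.
have cont : continuous (g \o clamp).
  move=> x; apply/cvgrPdist_le => e e0.
  have [d1 d10 d1P] := survival_ratio_close beta_ge0 beta_sum e0.
  near=> y; apply: d1P => //; apply: le_trans (clamp_lip _ _) _.
  near: y; exact: cvgr_dist_le.
have [c cI cmin] := EVT_min tsd (continuous_subspaceT cont).
move: cI; rewrite in_itv /= => /andP[c0 cd].
have gc : 1 < g c by apply: survival_ratio_gt1 => //; apply: le_lt_trans cd _; lra.
exists (g c - 1) => [|t t0 td]; first by rewrite subr_gt0.
have := cmin t; rewrite in_itv /= t0 td => /(_ isT); rewrite !clampK //.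
lra.
Unshelve. all: by end_near. Qed.

End Threshold.

(** * Concentration of the fraction of identifiable vertices *)

Lemma exists_nat_ge (R : realType) (x : R) : exists n : nat, x <= n%:R.
Proof. by exists (Num.truncn x).+1; rewrite ltW // truncnS_gt. Qed.

Section Concentration.
Variables (R : realType) (beta : nat -> R).
Hypothesis beta_ge0 : forall k, (1 <= k)%N -> 0 <= beta k.
Hypothesis beta_sum : cvgn (series (fun k => k%:R * beta k)).
Hypothesis no_zero : forall t : R, 0 <= t -> t < tstar beta ->
  beta_deriv beta t + ln (1 - t) != 0.

Local Notation C := (total_weight beta).
Local Notation g := (survival_ratio beta).
Local Notation ts := (tstar beta).

(* Only [q n] with [n <= n0] enters the law of [#|V^*|] up to [n0], and freezing
   [q] beyond [n0] keeps [(1 - n / N) / q n] away from 1 there. *)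
Lemma truncated_law_bound N n0 (k : R) (bad : pred nat) :
  (n0 < N.+2)%N -> 0 < k ->
  (forall n, (n0 < n)%N -> bad n) ->
  (forall n, (n <= N.+2)%N -> bad n ->
     k <= `|(N.+2 - n)%:R / N.+2%:R * expR (patch_rate beta N.+2 (minn n n0)) - 1|) ->
  \sum_(n < N.+3 | bad n) goncarov_law (no_patch_prob beta N.+2) N.+2 n
  <= expR C / N.+2%:R / k ^+ 2.
Proof.
move=> n0N k0 badn0 badk; set q := no_patch_prob beta N.+2.
pose qt n := q (minn n n0).
have qt_gt0 n : 0 < qt n by exact: expR_gt0.
have qt_dec n : qt n.+1 <= qt n.
  rewrite ler_expR lerN2; apply: le_patch_rate => //; lia.
have qt0 : qt 0%N <= 1 by rewrite expR_le1 oppr_le0 patch_rate_ge0.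
have qtV n : (qt n)^-1 = expR (patch_rate beta N.+2 (minn n n0)).
  by rewrite /qt /q /no_patch_prob expRN invrK.
have qtV_le n : (qt n)^-1 <= expR C.
  by rewrite qtV ler_expR; apply: patch_rate_le => //; lia.
have var := goncarov_law_variance qt_gt0 qt_dec qt0 qtV_le N.
have law_ge0 := goncarov_law_ge0 qt_gt0 qt_dec qt0 N.+2.
have good_eq n : ~~ bad n -> goncarov_law q N.+2 n = goncarov_law qt N.+2 n.
  move=> nb; have nn0 : (n <= n0)%N by rewrite leqNgt; apply: contra nb; apply: badn0.
  rewrite /goncarov_law; congr (_ * _ * _).
    by rewrite (@eq_goncarov _ q qt) // => i ni; rewrite /qt (minn_idPl _) //; lia.
  by rewrite /qt (minn_idPl nn0).
(* Both laws have total mass 1 and agree at every good [n], so they give the bad event the same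
   mass. *)
have -> : \sum_(n < N.+3 | bad n) goncarov_law q N.+2 n =
    \sum_(n < N.+3 | bad n) goncarov_law qt N.+2 n.
  have s1 := goncarov_law_sum q N.+2; have s2 := goncarov_law_sum qt N.+2.
  rewrite (bigID (fun n : 'I_N.+3 => bad n)) /= in s1.
  rewrite (bigID (fun n : 'I_N.+3 => bad n)) /= in s2.
  apply: (addIr (\sum_(n < N.+3 | ~~ bad n) goncarov_law qt N.+2 n)).
  rewrite s2 -s1; congr (_ + _); apply: eq_bigr => n nb; exact/esym/good_eq.
rewrite ler_pdivlMr ?exprn_gt0 //; apply: le_trans var.
rewrite mulr_suml big_mkcond; apply: ler_sum => n _; case: ifP => bn; last first.
  by rewrite mulr_ge0 // sqr_ge0.
rewrite ler_wpM2l // -[X in _ <= X]real_normK ?num_real // ler_sqr ?nnegrE ?(ltW k0) //.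
by rewrite qtV; apply: badk => //; rewrite -ltnS.
Qed.

Lemma card_identifiable_concentration (d eta : R) : 0 < d -> 0 < eta ->
  exists N0 : nat, forall N, (N0 <= N)%N ->
  (@hyper_expect R beta N (fun L =>
     (d < `|#|identifiable L|%:R / N%:R - ts|)%R%:R)%R <= eta%:E)%E.
Proof.
move=> d0 eta0.
have [s [tss sd s1 gs]] := subcritical_near beta_ge0 beta_sum d0.
have [k1 k10 k1P] := survival_ratio_lower beta_ge0 beta_sum no_zero d0.
have ts0 := tstar_ge0 beta_ge0 beta_sum.
(* A third of the margin: two approximation errors of size [k] still leave [k]. *)
pose k := Num.min k1 (1 - g s) / 3.
have k0 : 0 < k by rewrite divr_gt0 // lt_min k10 subr_gt0.
have kk1 : 3 * k <= k1 by rewrite mulrC divfK ?pnatr_eq0 // ge_min lexx.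
have kgs : 3 * k <= 1 - g s by rewrite mulrC divfK ?pnatr_eq0 // ge_min lexx orbT.
have [d1 d10 d1P] := survival_ratio_close beta_ge0 beta_sum k0.
have [N1 N1P] := patch_survival_close beta_ge0 beta_sum k0.
have [N2 N2P] := exists_nat_ge d1^-1.
have [N3 N3P] := exists_nat_ge (expR C / k ^+ 2 / eta).
exists (N1 + N2 + N3).+2 => -[|[//|N]] // NN.
have [N1N [N2N N3N]] : (N1 <= N.+2 /\ N2 <= N.+2 /\ N3 <= N.+2)%N.
  by move: NN; clear; lia.
set M : R := N.+2%:R.
have M0 : 0 < M by rewrite ltr0n.
have MN2 : M^-1 <= d1.
  rewrite -[d1]invrK lef_pV2 ?posrE ?invr_gt0 //.
  by apply: le_trans N2P _; rewrite ler_nat.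
have MN3 : expR C / M / k ^+ 2 <= eta.
  rewrite mulrAC ler_pdivrMr // [eta * M]mulrC -ler_pdivrMr //.
  by apply: le_trans N3P _; rewrite ler_nat.
have s0 : 0 <= s := le_trans ts0 tss.
have s01 : 0 <= s <= 1 by rewrite s0 ltW.
pose n0 := Num.truncn (s * M).
have /andP[n0s sn0] : n0%:R <= s * M < n0.+1%:R by apply: truncn_itv; rewrite mulr_ge0 // ltW.
have n0M : n0%:R / M <= s by rewrite ler_pdivrMr.
have n0N : (n0 < N.+2)%N.
  by rewrite -(ltr_nat R); apply: le_lt_trans n0s _; rewrite -/M gtr_pMl.
have frac01 n : (n <= N.+2)%N -> 0 <= (n%:R / M : R) <= 1.
  by move=> nN; rewrite divr_ge0 ?(ltW M0) //= ler_pdivrMr // mul1r ler_nat.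
pose bad n := (n%:R / M < ts - d) || (n0 < n)%N.
have badk n : (n <= N.+2)%N -> bad n ->
    k <= `|(N.+2 - n)%:R / N.+2%:R * expR (patch_rate beta N.+2 (minn n n0)) - 1|.
  move=> nN; rewrite /bad -/M; have [nn0|nn0] := leqP n n0.
    rewrite orbF => nts.
    have := N1P N.+2 n; rewrite -/M nN => /(_ _ isT).
    have /andP[f0 f1] := frac01 n nN.
    have := k1P _ f0 (ltW nts).
    set x := _ * expR _ => gx xP.
    have {}xP : `|x - g (n%:R / M)| <= k by exact: xP.
    apply: le_trans (ler_norm _); move: xP; rewrite ler_norml => /andP[]; lra.
  move=> _.
  have := N1P N.+2 n0; rewrite -/M (ltnW n0N) => /(_ _ isT).
  set x := _ * expR _ => xP.
  have {}xP : `|x - g (n0%:R / M)| <= k by exact: xP.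
  have : `|g s - g (n0%:R / M)| <= k.
    apply: d1P => //; first exact/frac01/ltnW.
    rewrite ger0_norm ?subr_ge0 //; apply: le_trans MN2.
    by rewrite lerBlDl -{2}[M^-1]mul1r -mulrDl ler_pdivlMr // natr1 ltW.
  set y := _ * expR _.
  (* With [q] frozen at [n0], only the decreasing factor [N.+2 - n] still varies. *)
  have yx : y <= x.
    rewrite /y /x ler_wpM2r ?expR_ge0 // ler_wpM2r ?invr_ge0 ?(ltW M0) //.
    by rewrite ler_nat leq_sub2l // ltnW.
  rewrite -normrN => gP; rewrite -normrN; apply: le_trans (ler_norm _).
  by move: xP gP; rewrite !ler_norml => /andP[? ?] /andP[? ?]; lra.
apply: (@le_trans _ _ (\sum_(n < N.+3) (bad n)%:R * goncarov_law (no_patch_prob beta N.+2) N.+2 n)%:E).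
  rewrite -(hyper_expect_card_identifiable N.+2 beta_ge0 (u := fun n => (bad n)%:R)) //.
  apply: le_hyper_expect => [A|L]; first exact: hyper_rate_ge0.
  rewrite ler_nat; set X := #|identifiable L|; case: ltP => // dX.
  rewrite lt0b /bad; apply: contraLR dX => /norP[]; rewrite -leNgt -leqNgt => X1 X2.
  rewrite -leNgt ler_norml; apply/andP; split; first by rewrite lerBrDr addrC.
  rewrite lerBlDl; apply: le_trans sd; apply: le_trans n0M.
  by rewrite ler_wpM2r ?invr_ge0 ?(ltW M0) // ler_nat.
rewrite lee_fin; apply: le_trans MN3.
apply: le_trans (truncated_law_bound n0N k0 _ badk).
  by rewrite [leRHS]big_mkcond; apply: ler_sum => n _; case: (bad n); rewrite ?mul1r ?mul0r.
by move=> n nn0; rewrite /bad nn0 orbT.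
Qed.

End Concentration.

(** * Second moment of the number of essential hyperedges *)

Section SecondMoment.
Variables (R : realType) (beta : nat -> R).
Hypothesis beta_ge0 : forall k, (1 <= k)%N -> 0 <= beta k.
Hypothesis beta_sum : cvgn (series (fun k => k%:R * beta k)).
Variables (N : nat) (K : pred nat).
Implicit Types (L : hypergraph N) (A B : {set 'I_N}).

Local Notation C := (total_weight beta).
Local Notation EE := (@hyper_expect R beta N).
Local Notation rate := (hyper_rate beta).
Local Notation e A L := ((completes L A)%:R : R).
Local Notation card_id L := (#|identifiable L|%:R : R).
Local Notation r0 := (@hyper_rate_ge0 R beta N beta_ge0).

(** [K] selects the hyperedge sizes; [pred1 k] and the positive sizes give the two assertions of the
    theorem. *)
Definition essential_on L : nat :=
  (\sum_(A : {set 'I_N} | K #|A|)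
     (if #|identifiable (remove_edge L A)| < #|identifiable L| then L A else 0))%N.

Definition completing_rate L : R := \sum_(A : {set 'I_N} | K #|A|) rate A * e A L.
Local Notation Z L := ((essential_on L)%:R : R).
Local Notation W := completing_rate.

Lemma essential_onE L :
  Z L = \sum_(A : {set 'I_N} | K #|A|) (L A)%:R * e A (remove_edge L A).
Proof.
rewrite /essential_on natr_sum; apply: eq_bigr => A _.
have [LA|LA] := posnP (L A); first by rewrite LA if_same mul0r.
rewrite -{2}(remove_edgeK LA) identifiable_add_edge_lt.
by case: (completes _ _); rewrite ?mulr1 ?mulr0.
Qed.

Lemma completing_rate_ge0 L : 0 <= W L.
Proof. by apply: sumr_ge0 => A _; rewrite mulr_ge0 // r0. Qed.

Lemma hyper_expect_essential_on : EE (fun L => Z L) = EE W.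
Proof.
under [LHS]eq_hyper_expect do rewrite essential_onE.
rewrite /completing_rate !hyper_expect_sum; try exact: r0; last 2 first.
- by move=> A L _; rewrite mulr_ge0 // r0.
- by move=> A L _; rewrite mulr_ge0.
apply: eq_bigr => A _; rewrite (mecke r0 A (h := fun L => e A L)) //.
by rewrite hyper_expectZ //; exact: r0.
Qed.

Lemma completes_eq0 L A : completes L A -> L A = 0%N.
Proof.
move=> cA; apply/eqP; apply: contraT; rewrite -lt0n => LA.
by have /closed_underP/(_ A LA) := identifiable_closed L; rewrite -/(completes L A) cA.
Qed.

(** The term [A = B] counts a single hyperedge, since completing [B] forces [L B = 0]. In the other
    terms [L] is written as [add_edge (remove_edge L A) A], ready for a second use of the Mecke
    formula. *)
Lemma essential_on_add_edge L B : K #|B| ->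
  e B L * Z (add_edge L B) <= e B L + \sum_(A : {set 'I_N} | K #|A|)
    (L A)%:R * (e A (add_edge (remove_edge L A) B) * e B (add_edge (remove_edge L A) A)).
Proof.
move=> KB; rewrite essential_onE mulr_sumr.
rewrite (bigD1 B) //= [X in _ <= _ + X](bigD1 B) //= addrA; apply: lerD.
  rewrite add_edgeK ffunE eqxx addn1.
  have [cB|_] := boolP (completes L B); last first.
    by rewrite !mul0r add0r !mulr_ge0.
  by rewrite (completes_eq0 cB) !mulr1 lerDl !mulr_ge0.
apply: ler_sum => A /andP[_ AB]; rewrite ffunE (negPf AB) addn0.
have [->|LA] := posnP (L A); first by rewrite !(mul0r, mulr0).
rewrite (remove_edgeK LA) mulrCA le_eqVlt; apply/orP; left; apply/eqP.
rewrite [e B L * _]mulrC; congr (_ * (_%:R * _)); congr (nat_of_bool (completes _ _)).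
apply/ffunP => D; rewrite !ffunE; have [->|DA] := eqVneq D A; last by [].
by rewrite (negPf AB) !addn0.
Qed.

Definition newly_completes L A B : R := (completes (add_edge L B) A && ~~ completes L A)%:R.

Lemma hyper_expect_essential_on_sqr :
  (EE (fun L => Z L ^+ 2)%R <= EE (fun L => \sum_(B : {set 'I_N} | K #|B|) rate B *
     (e B L + \sum_(A : {set 'I_N} | K #|A|)
        rate A * (e A (add_edge L B) * e B (add_edge L A))))%R)%E.
Proof.
have -> : EE (fun L => Z L ^+ 2) = (\sum_(B : {set 'I_N} | K #|B|)
    (rate B)%:E * EE (fun L => e B L * Z (add_edge L B))%R)%E.
  transitivity (EE (fun L => \sum_(B : {set 'I_N} | K #|B|)
     (L B)%:R * (e B (remove_edge L B) * Z (add_edge (remove_edge L B) B)))).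
    apply: eq_hyper_expect => L; rewrite expr2 {1}essential_onE mulr_suml.
    apply: eq_bigr => B _; have [->|LB] := posnP (L B); first by rewrite !mul0r.
    by rewrite remove_edgeK // mulrA.
  rewrite hyper_expect_sum; [|exact: r0|by move=> B L _; rewrite !mulr_ge0].
  apply: eq_bigr => B _.
  rewrite (mecke r0 B (h := fun L => e B L * Z (add_edge L B))) //.
rewrite hyper_expect_sum; last 2 first.
- exact: r0.
- move=> B L _; rewrite mulr_ge0 ?r0 // addr_ge0 // sumr_ge0 // => A _.
  by rewrite !mulr_ge0 ?r0.
apply: lee_sum => B KB; rewrite hyper_expectZ ?r0 //; last 2 first.
- exact: r0.
- by move=> L; rewrite addr_ge0 // sumr_ge0 // => A _; rewrite !mulr_ge0 ?r0.
apply: lee_wpmul2l; first by rewrite lee_fin r0.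
apply: (@le_trans _ _ (EE (fun L => e B L + \sum_(A : {set 'I_N} | K #|A|)
    (L A)%:R * (e A (add_edge (remove_edge L A) B) * e B (add_edge (remove_edge L A) A))))).
  by apply: le_hyper_expect => [|L]; [exact: r0|exact: essential_on_add_edge].
rewrite hyper_expectD; last 3 first.
- exact: r0.
- by [].
- by move=> L; rewrite sumr_ge0 // => A _; rewrite !mulr_ge0.
rewrite [leRHS]hyper_expectD; last 3 first.
- exact: r0.
- by [].
- by move=> L; rewrite sumr_ge0 // => A _; rewrite !mulr_ge0 ?r0.
rewrite leeD2l // !hyper_expect_sum; try exact: r0; last 2 first.
- by move=> A L _; rewrite !mulr_ge0 ?r0.
- by move=> A L _; rewrite !mulr_ge0.
apply: lee_sum => A _.
rewrite (mecke r0 A (h := fun L => e A (add_edge L B) * e B (add_edge L A))).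
  rewrite hyper_expectZ ?r0 //; first exact: r0.
by move=> L /=; rewrite mulr_ge0.
Qed.

(** The expected degree of [v] is the patch rate at [n = N - 1]: the sets containing [v] are those
    leaving the complement of [v] in one vertex. *)
Lemma sum_rate_mem (v : 'I_N) : \sum_(A : {set 'I_N} | v \in A) rate A <= C.
Proof.
have N0 : (0 < N)%N := leq_ltn_trans (leq0n v) (ltn_ord v).
have -> : \sum_(A : {set 'I_N} | v \in A) rate A =
    \sum_(A : {set 'I_N} | boundary (~: [set v])%SET finset.setT A) size_rate beta N #|A|.
  apply: eq_bigl => A; rewrite /boundary finset.subsetT /= finset.setDE finset.setCK.
  apply/idP/idP => [vA|/cards1P[u uE]].
    by rewrite (finset.setIidPr _) ?finset.sub1set // cards1.
  have : u \in A :&: [set v]%SET by rewrite uE inE.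
  by rewrite !inE => /andP[uA /eqP <-].
rewrite sum_boundary_card ?finset.subsetT // finset.setTD finset.setCK cards1 mul1r.
rewrite -/(patch_rate beta N _); apply: patch_rate_le => //.
by rewrite cardsC1 card_ord; lia.
Qed.

(** A set that completes only after the addition of [B] must contain a newly identified vertex, and
    each vertex has expected degree at most [C]. *)
Lemma sum_newly_completes L B :
  \sum_(A : {set 'I_N} | K #|A|) rate A * newly_completes L A B
  <= C * (card_id (add_edge L B) - card_id L).
Proof.
pose D := identifiable (add_edge L B) :\: identifiable L.
have XD : card_id (add_edge L B) - card_id L = #|D|%:R.
  rewrite /D cardsDS ?identifiable_add_edge_sub // natrB //.
  exact/subset_leq_card/identifiable_add_edge_sub.
rewrite XD.
apply: (@le_trans _ _ (\sum_(A : {set 'I_N}) rate A * \sum_(v in D) (v \in A)%:R)).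
  rewrite big_mkcond; apply: ler_sum => A _; case: ifP => _; last first.
    by rewrite mulr_ge0 ?r0 // sumr_ge0.
  rewrite ler_wpM2l ?r0 // /newly_completes; case: andP => [[cA ncA]|_]; last first.
    by rewrite sumr_ge0.
  suff [v vD vA] : exists2 v, v \in D & v \in A.
    by rewrite (bigD1 v) //= vA lerDl sumr_ge0.
  apply: contrapT => noD; case/negP: ncA; rewrite /completes in cA *.
  suff -> : A :\: identifiable L = A :\: identifiable (add_edge L B) by [].
  apply/finset.setP => w; rewrite !inE; case wA: (w \in A); rewrite ?andbF // !andbT.
  apply/idP/idP => [wL|]; last exact/contra/(fintype.subsetP (identifiable_add_edge_sub L B)).
  by apply/negP => wLB; apply: noD; exists w; rewrite // inE wL.
under eq_bigr do rewrite mulr_sumr.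
rewrite exchange_big /= mulr_natr -sumr_const; apply: ler_sum => v _.
apply: le_trans (sum_rate_mem v); rewrite [leRHS]big_mkcond; apply: ler_sum => A _.
by case: (v \in A); rewrite ?mulr1 ?mulr0.
Qed.

(** If [A] completes after adding [B] and [B] after adding [A], then either both complete already,
    which gives the square of [W], or one of them newly completes. The two influence sums coincide
    by symmetry. *)
Lemma completing_square_bound L :
  \sum_(B : {set 'I_N} | K #|B|) rate B *
     (e B L + \sum_(A : {set 'I_N} | K #|A|)
        rate A * (e A (add_edge L B) * e B (add_edge L A)))
  <= W L + W L ^+ 2 + 2 * C * \sum_(B : {set 'I_N}) rate B * (card_id (add_edge L B) - card_id L).
Proof.
pose Q := \sum_(B : {set 'I_N} | K #|B|) \sum_(A : {set 'I_N} | K #|A|)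
  rate B * (rate A * newly_completes L A B).
have Q_le : Q <= C * \sum_(B : {set 'I_N}) rate B * (card_id (add_edge L B) - card_id L).
  rewrite mulr_sumr /Q big_mkcond; apply: ler_sum => B _; case: ifP => _; last first.
    rewrite !mulr_ge0 ?r0 ?total_weight_ge0 // subr_ge0 ler_nat.
    exact/subset_leq_card/identifiable_add_edge_sub.
  rewrite -mulr_sumr mulrCA ler_wpM2l ?r0 //; exact: sum_newly_completes.
apply: (@le_trans _ _ (W L + W L ^+ 2 + (Q + Q))); last by lra.
have QC : Q = \sum_(B : {set 'I_N} | K #|B|) \sum_(A : {set 'I_N} | K #|A|)
    rate B * (rate A * newly_completes L B A).
  rewrite /Q exchange_big /=; apply: eq_bigr => B _; apply: eq_bigr => A _.
  by rewrite mulrCA.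
rewrite {2}QC /Q.
under eq_bigr do rewrite mulrDr.
rewrite big_split /= -addrA lerD // expr2 {1}/completing_rate mulr_suml -!big_split /=.
apply: ler_sum => B _; rewrite -!mulrA /completing_rate !mulr_sumr -!big_split /=.
apply: ler_sum => A _.
rewrite [e B L * _]mulrCA -!mulrDr ler_wpM2l ?r0 // ler_wpM2l ?r0 //.
rewrite /newly_completes.
by case: (completes L A); case: (completes L B); case: (completes _ A); case: (completes _ B);
  rewrite /= ?(mulr0, mulr1, addr0, add0r, mul0r); lra.
Qed.

End SecondMoment.

(** * Influence as a covariance, and the deviation of the essential count *)

Section Variance.
Variables (R : realType) (beta : nat -> R).
Hypothesis beta_ge0 : forall k, (1 <= k)%N -> 0 <= beta k.
Hypothesis beta_sum : cvgn (series (fun k => k%:R * beta k)).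
Variables (N : nat) (K : pred nat).
Implicit Types (L : hypergraph N) (A B : {set 'I_N}).

Local Notation C := (total_weight beta).
Local Notation EE := (@hyper_expect R beta N).
Local Notation rate := (hyper_rate beta).
Local Notation card_id L := (#|identifiable L|%:R : R).
Local Notation r0 := (@hyper_rate_ge0 R beta N beta_ge0).

Definition edge_count L : R := \sum_(B : {set 'I_N}) (L B)%:R.
Definition total_rate : R := \sum_(B : {set 'I_N}) rate B.
Local Notation mu := total_rate.

Lemma total_rate_ge0 : 0 <= mu.
Proof. by apply: sumr_ge0 => B _; exact: r0. Qed.

Lemma total_rate_le : mu <= C * N%:R.
Proof.
apply: (@le_trans _ _ (\sum_(B : {set 'I_N}) \sum_(v in B) rate B)).
  apply: ler_sum => B _; rewrite sumr_const /hyper_rate.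
  have [->|] := posnP #|B|; first by rewrite mulr0n.
  case: (#|B|) => // n _; rewrite mulrS lerDl mulrn_wge0 //=.
  by rewrite divr_ge0 // mulr_ge0 // beta_ge0.
rewrite (exchange_big_dep predT) //= mulr_natr -[X in _ *+ X](card_ord N) -sumr_const.
by apply: ler_sum => v _; exact: sum_rate_mem.
Qed.

Lemma edge_count_ge0 L : 0 <= edge_count L.
Proof. exact: sumr_ge0. Qed.

Lemma edge_count_add_edge L B : edge_count (add_edge L B) = edge_count L + 1.
Proof.
rewrite /edge_count (bigD1 B) //= [in RHS](bigD1 B) //= ffunE eqxx addn1 -natr1.
rewrite addrAC; congr (_ + _ + _).
by apply: eq_bigr => A /negPf AB; rewrite ffunE AB addn0.
Qed.

Lemma hyper_expect_edge_count (h : hypergraph N -> R) : (forall L, 0 <= h L) ->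
  EE (fun L => edge_count L * h L) =
  EE (fun L => \sum_(B : {set 'I_N}) rate B * h (add_edge L B)).
Proof.
move=> h0; under eq_hyper_expect do rewrite /edge_count mulr_suml.
rewrite !hyper_expect_sum; try exact: r0; last 2 first.
- by move=> B L _; rewrite mulr_ge0 // r0.
- by move=> B L _; rewrite mulr_ge0.
apply: eq_bigr => B _; rewrite (mecke_add r0) // hyper_expectZ ?r0 //; exact: r0.
Qed.

Lemma hyper_expect_edge_count1 : EE edge_count = mu%:E.
Proof.
have := @hyper_expect_edge_count (fun=> 1) (fun=> ler01).
rewrite (eq_hyper_expect _ (h' := edge_count)); last by move=> L; rewrite mulr1.
move=> ->; rewrite -(hyper_expect_cst r0 total_rate_ge0).
by apply: eq_hyper_expect => L; apply: eq_bigr => B _; rewrite mulr1.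
Qed.

Lemma hyper_expect_edge_count_sqr :
  EE (fun L => edge_count L ^+ 2) = (mu * (mu + 1))%:E.
Proof.
have := hyper_expect_edge_count edge_count_ge0.
rewrite (eq_hyper_expect _ (h' := fun L => edge_count L ^+ 2)); last by [].
move=> ->; rewrite (eq_hyper_expect _ (h' := fun L => mu * (edge_count L + 1))); last first.
  by move=> L; rewrite /total_rate mulr_suml; apply: eq_bigr => B _; rewrite edge_count_add_edge.
rewrite hyper_expectZ ?total_rate_ge0 //; last 2 first.
- exact: r0.
- by move=> L; rewrite addr_ge0 ?edge_count_ge0.
rewrite hyper_expectD //; [|exact: r0|exact: edge_count_ge0].
by rewrite hyper_expect_edge_count1 hyper_expect_cst ?ler01 //; exact: r0.
Qed.

Lemma edge_count_variance : EE (fun L => (edge_count L - mu) ^+ 2) = mu%:E.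
Proof.
have mu0 := total_rate_ge0.
(* The cross term is moved to the other side so that every expectation is of a nonnegative
   function. *)
have : (EE (fun L => (edge_count L - mu) ^+ 2)%R + EE (fun L => 2 * mu * edge_count L)%R
    = EE (fun L => edge_count L ^+ 2)%R + EE (fun=> mu ^+ 2)%R)%E.
  rewrite -!hyper_expectD; try exact: r0; try by move=> *; rewrite sqr_ge0.
    by apply: eq_hyper_expect => L; ring.
  by move=> L; rewrite !mulr_ge0 // edge_count_ge0.
rewrite hyper_expect_edge_count_sqr hyper_expect_cst ?sqr_ge0 //; last exact: r0.
rewrite hyper_expectZ ?hyper_expect_edge_count1 ?mulr_ge0 //; last 2 first.
- exact: r0.
- exact: edge_count_ge0.
case: (EE _) => [x||] //= [xE]; congr (_%:E); lra.
Qed.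

(** By the Mecke formula the left side is the covariance of [card_id] with the Poisson variable
    [edge_count]. It is bounded using [card_id L <= N] and the variance [mu]; [a] remains free. *)
Lemma hyper_expect_influence (a : R) : 0 < a ->
  (EE (fun L => \sum_(B : {set 'I_N}) rate B * (card_id (add_edge L B) - card_id L))%R
   <= (N%:R * (a + mu / a))%:E)%E.
Proof.
move=> a0; have mu0 := total_rate_ge0.
have dX0 L B : 0 <= card_id (add_edge L B) - card_id L.
  by rewrite subr_ge0 ler_nat; exact/subset_leq_card/identifiable_add_edge_sub.
have XN L : card_id L <= N%:R by rewrite ler_nat -[X in (_ <= X)%N]card_ord max_card.
have finX : EE (fun L => mu * card_id L) \is a fin_num.
  rewrite ge0_fin_numE; last first.
    by apply: hyper_expect_ge0 => [|L]; [exact: r0|rewrite mulr_ge0].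
  apply: (@le_lt_trans _ _ (EE (fun=> mu * N%:R))).
    by apply: le_hyper_expect => [|L]; [exact: r0|rewrite ler_wpM2l].
  by rewrite hyper_expect_cst ?mulr_ge0 ?ltry //; exact: r0.
rewrite -(leeD2rE _ _ finX) -hyper_expectD; last 3 first.
- exact: r0.
- by move=> L; apply: sumr_ge0 => B _; rewrite mulr_ge0 ?r0.
- by move=> L; rewrite mulr_ge0.
rewrite (eq_hyper_expect _
  (h' := fun L => \sum_(B : {set 'I_N}) rate B * card_id (add_edge L B))); last first.
  move=> L; rewrite /total_rate mulr_suml -big_split /=; apply: eq_bigr => B _.
  by rewrite mulrBr subrK.
rewrite -(hyper_expect_edge_count (h := fun L => card_id L)) //.
have sq0 L : 0 <= N%:R * (a + (edge_count L - mu) ^+ 2 / a).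
  by rewrite mulr_ge0 // addr_ge0 ?(ltW a0) // divr_ge0 ?sqr_ge0 ?(ltW a0).
have -> : (N%:R * (a + mu / a))%:E = EE (fun L => N%:R * (a + (edge_count L - mu) ^+ 2 / a)).
  rewrite hyper_expectZ //; last 2 first.
  - exact: r0.
  - by move=> L; rewrite addr_ge0 ?(ltW a0) // divr_ge0 ?sqr_ge0 ?(ltW a0).
  rewrite hyper_expectD; last 3 first.
  - exact: r0.
  - by move=> _; exact: ltW.
  - by move=> L; rewrite divr_ge0 ?sqr_ge0 ?(ltW a0).
  rewrite hyper_expect_cst ?(ltW a0) //; last exact: r0.
  rewrite (eq_hyper_expect _ (h' := fun L => a^-1 * (edge_count L - mu) ^+ 2)); last first.
    by move=> L; rewrite mulrC.
  rewrite hyper_expectZ ?invr_ge0 ?(ltW a0) //; last 2 first.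
  - exact: r0.
  - by move=> L; rewrite sqr_ge0.
  by rewrite edge_count_variance [mu / a]mulrC.
rewrite -hyper_expectD //; last 2 first.
- exact: r0.
- by move=> L; rewrite mulr_ge0.
apply: le_hyper_expect => [|L]; first exact: r0.
rewrite -lerBlDr -mulrBl; set y := edge_count L - mu; clearbody y.
(* AM-GM in the form [y <= a + y^2 / a]. *)
have yle : y <= a + y ^+ 2 / a.
  rewrite -(ler_pM2r a0) mulrDl divfK ?gt_eqF //.
  have := sqr_ge0 (y - a); have := sqr_ge0 y; have := sqr_ge0 a; rewrite !expr2; nra.
have : 0 <= a + y ^+ 2 / a by rewrite addr_ge0 ?divr_ge0 ?sqr_ge0 // ltW.
have := XN L; have : 0 <= card_id L by [].
set m := card_id L; set z := a + _ => m0 mN z0.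
apply: (@le_trans _ _ (z * m)); first by rewrite ler_wpM2r.
by rewrite mulrC ler_wpM2r.
Qed.


Local Notation W := (@completing_rate R beta N K).
Local Notation Z L := ((essential_on K L)%:R : R).

Definition restrict_degrees (k : nat) : R := if K k then beta k else 0.
Local Notation betaK := restrict_degrees.

(** The completing sets are the boundary sets of [identifiable L], so [W] depends on [L] only
    through its cardinality. *)
Lemma completing_rateE L :
  W L = (N - #|identifiable L|)%:R * patch_rate betaK N #|identifiable L|.
Proof.
have -> : (N - #|identifiable L| = #|finset.setT :\: identifiable L|)%N.
  by rewrite cardsDS ?finset.subsetT // cardsT card_ord.
rewrite -[RHS](sum_boundary_card (size_rate betaK N) (finset.subsetT _)).
rewrite /completing_rate big_mkcond [RHS]big_mkcond /=; apply: eq_bigr => A _.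
rewrite /boundary finset.subsetT /= -/(completes L A) /hyper_rate /size_rate /restrict_degrees.
case: (K _); case: (completes _ _); rewrite ?mulr1 ?mulr0 ?mul0r //.
by rewrite if_same.
Qed.

Lemma le_patch_rate_restrict n : patch_rate betaK N n <= patch_rate beta N n.
Proof.
apply: ler_sum => j _; rewrite ler_wpM2l // /size_rate /= /restrict_degrees.
by case: (K _) => //; rewrite mulr0 mul0r divr_ge0 // mulr_ge0 // beta_ge0.
Qed.

Lemma completing_rate_le L : W L <= C * N%:R.
Proof.
have C0 := total_weight_ge0 beta_ge0 beta_sum.
have XN : (#|identifiable L| <= N)%N by rewrite -[X in (_ <= X)%N]card_ord max_card.
rewrite completing_rateE; move: XN; rewrite leq_eqVlt => /predU1P[->|XN].
  by rewrite subnn mul0r mulr_ge0.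
rewrite mulrC; apply: ler_pM => //.
- apply: sumr_ge0 => j _; rewrite mulr_ge0 // /size_rate /restrict_degrees /=.
  by case: (K _); rewrite ?mulr0 ?mul0r // divr_ge0 // mulr_ge0 // beta_ge0.
- by apply: le_trans (le_patch_rate_restrict _) _; exact: patch_rate_le.
- by rewrite ler_nat leq_subr.
Qed.

(** [Z] and [W] have equal means, so after expanding the squares only the difference of their second
    moments is left. *)
Lemma essential_on_deviation (c a : R) : 0 <= c -> 0 < a ->
  (EE (fun L => (Z L - c) ^+ 2)%R <= EE (fun L => (W L - c) ^+ 2)%R
     + (C * N%:R + 2 * C * (N%:R * (a + C * N%:R / a)))%:E)%E.
Proof.
move=> c0 a0; have C0 := total_weight_ge0 beta_ge0 beta_sum.
have W0 := @completing_rate_ge0 R beta beta_ge0 N K.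
pose V L := \sum_(B : {set 'I_N}) rate B * (card_id (add_edge L B) - card_id L).
have V0 L : 0 <= V L.
  apply: sumr_ge0 => B _; rewrite mulr_ge0 ?r0 // subr_ge0 ler_nat.
  exact/subset_leq_card/identifiable_add_edge_sub.
have EW : (EE W <= (C * N%:R)%:E)%E.
  rewrite -(hyper_expect_cst r0 (mulr_ge0 C0 (ler0n _ _))).
  by apply: le_hyper_expect; [exact: r0|exact: completing_rate_le].
have finW : EE (fun L => 2 * c * W L) \is a fin_num.
  rewrite hyper_expectZ ?mulr_ge0 //; last exact: r0.
  rewrite fin_numM // ge0_fin_numE ?(le_lt_trans EW) ?ltry //.
  by apply: hyper_expect_ge0; [exact: r0|exact: W0].
have square (F : hypergraph N -> R) : (forall L, 0 <= F L) ->
    (EE (fun L => (F L - c) ^+ 2)%R + EE (fun L => 2 * c * F L)%R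
     = EE (fun L => F L ^+ 2)%R + EE (fun=> c ^+ 2)%R)%E.
  move=> F0; rewrite -!hyper_expectD; try exact: r0; try by move=> *; rewrite sqr_ge0.
    by apply: eq_hyper_expect => L; ring.
  by move=> L; rewrite !mulr_ge0.
have ZW : EE (fun L => 2 * c * Z L) = EE (fun L => 2 * c * W L).
  rewrite !hyper_expectZ ?mulr_ge0 ?hyper_expect_essential_on //; exact: r0.
have Z2 : (EE (fun L => Z L ^+ 2)%R <= EE W + EE (fun L => W L ^+ 2)%R
    + (2 * C)%:E * EE V)%E.
  apply: le_trans (hyper_expect_essential_on_sqr beta_ge0 N K) _.
  rewrite -hyper_expectZ ?mulr_ge0 //; last exact: r0.
  rewrite -!hyper_expectD; try exact: r0; try by move=> *; rewrite ?addr_ge0 ?sqr_ge0 ?mulr_ge0.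
  by apply: le_hyper_expect => [|L]; [exact: r0|exact: completing_square_bound].
have V_le : ((2 * C)%:E * EE V <= (2 * C * (N%:R * (a + C * N%:R / a)))%:E)%E.
  rewrite [leRHS]EFinM lee_wpmul2l ?lee_fin ?mulr_ge0 //.
  apply: le_trans (hyper_expect_influence a0) _; rewrite lee_fin ler_wpM2l // lerD2l.
  by rewrite ler_wpM2r ?invr_ge0 ?(ltW a0) // total_rate_le.
rewrite -(leeD2rE _ _ finW) -{1}ZW square //.
apply: le_trans (leeD2r _ Z2) _; rewrite addeAC [leRHS]addeAC (square _ W0).
rewrite EFinD.
have -> : (EE W + EE (fun L => W L ^+ 2)%R + EE (fun=> (c ^+ 2)%R)
   = EE (fun L => W L ^+ 2)%R + EE (fun=> (c ^+ 2)%R) + EE W)%E.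
  by rewrite -addeA addeC.
by rewrite -addeA leeD2l // leeD.
Qed.

End Variance.

(** * Convergence for a prescribed set of hyperedge sizes *)

Section RestrictDegrees.
Variables (R : realType) (beta : nat -> R).
Hypothesis beta_ge0 : forall k, (1 <= k)%N -> 0 <= beta k.
Hypothesis beta_sum : cvgn (series (fun k => k%:R * beta k)).
Hypothesis no_zero : forall t : R, 0 <= t -> t < tstar beta ->
  beta_deriv beta t + ln (1 - t) != 0.
Variable K : pred nat.

Local Notation C := (total_weight beta).
Local Notation ts := (tstar beta).
Local Notation betaK := (restrict_degrees beta K).
Local Notation EE N := (@hyper_expect R beta N).

Lemma restrict_degrees_ge0 k : (1 <= k)%N -> 0 <= betaK k.
Proof. by rewrite /restrict_degrees; case: (K k) => //; apply: beta_ge0. Qed.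

Lemma restrict_degrees_sum : cvgn (series (fun k => k%:R * betaK k)).
Proof.
apply: series_le_cvg beta_sum => -[|k]; rewrite ?mul0r //.
- by rewrite mulr_ge0 // restrict_degrees_ge0.
- by rewrite mulr_ge0 // beta_ge0.
- rewrite ler_wpM2l // /restrict_degrees; case: (K _) => //; exact: beta_ge0.
Qed.

Lemma beta_deriv_restrict_le t : 0 <= t <= 1 -> beta_deriv betaK t <= C.
Proof.
move=> t01; rewrite beta_derivE //; [|exact: restrict_degrees_ge0|exact: restrict_degrees_sum].
apply: limr_le.
  apply: is_cvg_weighted_sum (expr_unit t01); first exact: restrict_degrees_ge0.
  exact: restrict_degrees_sum.
near=> n; apply: le_trans (series_degree_weight_le beta_ge0 beta_sum n).
apply: ler_sum => j _; have /andP[a0 a1] := expr_unit t01 j.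
apply: (@le_trans _ _ (degree_weight betaK j)).
  by rewrite ler_piMr // degree_weight_ge0 //; exact: restrict_degrees_ge0.
rewrite ler_wpM2l // /restrict_degrees; case: (K _) => //; exact: beta_ge0.
Unshelve. all: by end_near. Qed.

Definition essential_limit : R := (1 - ts) * beta_deriv betaK ts.
Local Notation c := essential_limit.

Lemma essential_limit_ge0 : 0 <= c.
Proof.
rewrite mulr_ge0 ?subr_ge0 ?(ltW (tstar_lt1 beta_ge0 beta_sum)) //.
apply: beta_deriv_ge0 (tstar01 beta_ge0 beta_sum).
- exact: restrict_degrees_ge0.
- exact: restrict_degrees_sum.
Qed.

Lemma essential_limit_le : c <= C.
Proof.
have ts01 := tstar01 beta_ge0 beta_sum; have /andP[ts0 ts1] := ts01.
have b0 : 0 <= beta_deriv betaK ts.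
  by apply: beta_deriv_ge0 => //; [exact: restrict_degrees_ge0|exact: restrict_degrees_sum].
apply: le_trans (beta_deriv_restrict_le ts01).
by rewrite /essential_limit ler_piMl // gerBl.
Qed.

Lemma completing_rate_concentration (eta : R) : 0 < eta ->
  exists N0 : nat, forall N, (N0 <= N)%N ->
  (EE N (fun L => (completing_rate beta K L - c * N%:R) ^+ 2)%R
    <= (eta * N%:R ^+ 2)%:E)%E.
Proof.
move=> eta0; have C0 := total_weight_ge0 beta_ge0 beta_sum.
have ts01 := tstar01 beta_ge0 beta_sum.
have ts0 := tstar_ge0 beta_ge0 beta_sum; have ts1 := tstar_lt1 beta_ge0 beta_sum.
have c0 := essential_limit_ge0; have cC := essential_limit_le.
(* The normalised deviation [x] is always at most [C1] in absolute value, and at most [rho] near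
   [ts]. So its square is at most [rho * C1 = eta / 2] there, and the far event costs [C1 ^+ 2]
   times its probability. *)
pose C1 := C + 1; have C10 : 0 < C1 by rewrite /C1; lra.
pose rho := eta / 2 / C1; have rho0 : 0 < rho by rewrite !divr_gt0.
have rho3 : 0 < rho / 3 by rewrite divr_gt0.
have [d1 d10 d1P] := beta_deriv_close restrict_degrees_ge0 restrict_degrees_sum rho3.
have [N1 N1P] := patch_rate_close restrict_degrees_ge0 restrict_degrees_sum rho3.
(* The three bounds serve the continuity of [beta_deriv], the strict inequality [n < N] asked by
   [patch_rate_close], and the error from replacing [y] by [ts]. *)
pose d := Num.min d1 (Num.min ((1 - ts) / 2) (rho / 3 / C1)).
have d0 : 0 < d by rewrite !lt_min d10 !divr_gt0 // subr_gt0.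
have dd1 : d <= d1 by rewrite ge_min lexx.
have dts : d <= (1 - ts) / 2 by rewrite !ge_min lexx orbT.
have drho : d * C1 <= rho / 3 by rewrite -ler_pdivlMr // !ge_min lexx !orbT.
have eta1 : 0 < eta / 2 / C1 ^+ 2 by rewrite !divr_gt0 ?exprn_gt0.
have [N2 N2P] := card_identifiable_concentration beta_ge0 beta_sum no_zero d0 eta1.
exists (N1 + N2).+1 => N NN.
have [Npos [N1N N2N]] : (0 < N /\ N1 <= N /\ N2 <= N)%N by move: NN; clear; lia.
have N0 : (0 : R) < N%:R by rewrite ltr0n.
pose far (L : hypergraph N) : R := (d < `|#|identifiable L|%:R / N%:R - ts|)%R%:R.
have r0 := @hyper_rate_ge0 R beta N beta_ge0.
apply: (@le_trans _ _ (EE N (fun L => N%:R ^+ 2 * (eta / 2 + C1 ^+ 2 * far L)))); last first.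
  rewrite hyper_expectZ ?sqr_ge0 //; last first.
    by move=> L; rewrite addr_ge0 ?mulr_ge0 ?sqr_ge0 ?divr_ge0 // ltW.
  rewrite hyper_expectD //; last 2 first.
  - by move=> L; rewrite divr_ge0 // ltW.
  - by move=> L; rewrite mulr_ge0 ?sqr_ge0.
  rewrite hyper_expect_cst ?divr_ge0 ?(ltW eta0) // hyper_expectZ ?sqr_ge0 //.
  rewrite [leRHS]EFinM [leRHS]muleC lee_wpmul2l ?lee_fin ?sqr_ge0 //.
  rewrite [eta in leRHS](splitr eta) EFinD leeD2l //.
  have -> : (eta / 2)%:E = ((C1 ^+ 2)%:E * (eta / 2 / C1 ^+ 2)%:E)%E.
    by rewrite muleC -EFinM divfK // gt_eqF // exprn_gt0.
  by rewrite lee_wpmul2l ?lee_fin ?sqr_ge0 //; apply: N2P.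
apply: le_hyper_expect => // L.
have W0 := completing_rate_ge0 beta_ge0 K L.
have WC := completing_rate_le beta_ge0 beta_sum K L.
pose x := completing_rate beta K L / N%:R - c.
have -> : completing_rate beta K L - c * N%:R = N%:R * x.
  by rewrite /x mulrBr mulrCA divff ?gt_eqF // mulr1 mulrC.
rewrite exprMn ler_wpM2l ?sqr_ge0 //.
have xC1 : `|x| <= C1.
  have : completing_rate beta K L / N%:R <= C by rewrite ler_pdivrMr.
  have : 0 <= completing_rate beta K L / N%:R by rewrite divr_ge0 ?(ltW N0).
  by rewrite /x /C1 ler_norml; lra.
rewrite /far; case: ltP => [_|near_ts].
  rewrite mulr1 ler_wpDl ?divr_ge0 ?(ltW eta0) //.
  by rewrite -[x ^+ 2]real_normK ?num_real // ler_sqr ?nnegrE ?(ltW C10).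
rewrite mulr0 addr0.
suff xrho : `|x| <= rho.
  rewrite -[x ^+ 2]real_normK ?num_real // expr2.
  apply: (@le_trans _ _ (rho * C1)); first exact: ler_pM.
  by rewrite /rho divfK // gt_eqF.
set n := #|identifiable L| in near_ts *; set y := n%:R / N%:R in near_ts *.
have nN : (n <= N)%N by rewrite -[X in (_ <= X)%N]card_ord max_card.
have y01 : 0 <= y <= 1 by rewrite divr_ge0 ?(ltW N0) //= ler_pdivrMr // mul1r ler_nat.
have nN' : (n < N)%N.
  rewrite -(ltr_nat R) -[ltRHS]mul1r -ltr_pdivrMr //.
  by move: near_ts; rewrite ler_norml -/y; lra.
set pr := patch_rate betaK N n; set b := beta_deriv betaK ts.
have prb : `|pr - b| <= rho / 3 + rho / 3.
  rewrite -(subrKA (beta_deriv betaK y)); apply: le_trans (ler_normD _ _) _.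
  apply: lerD; first exact: N1P.
  by apply: d1P => //; exact: le_trans dd1.
have b0 : 0 <= b.
  by apply: beta_deriv_ge0 => //; [exact: restrict_degrees_ge0|exact: restrict_degrees_sum].
have bC1 : b <= C1 by apply: le_trans (beta_deriv_restrict_le ts01) _; rewrite /C1 lerDl.
have -> : x = (1 - y) * (pr - b) - (y - ts) * b.
  rewrite /x completing_rateE -/n -/pr natrB // /essential_limit -/b /y.
  by field; rewrite gt_eqF.
have -> : rho = rho / 3 + rho / 3 + rho / 3 by field.
apply: le_trans (ler_normB _ _) _; rewrite !normrM; apply: lerD.
  apply: le_trans prb; rewrite ler_piMl // ger0_norm; move/andP: y01 => [? ?]; lra.
apply: le_trans drho; rewrite [`|b|]ger0_norm //; exact: ler_pM.
Qed.

Lemma essential_on_cvg (eps : R) : 0 < eps ->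
  (fun N : nat => hyper_prob beta
     [set L : hypergraph N | eps < `|(essential_on K L)%:R / N%:R - c|])
  @ \oo --> (0 : \bar R).
Proof.
move=> eps0; have C0 := total_weight_ge0 beta_ge0 beta_sum.
have c0 := essential_limit_ge0.
have bound (th : R) : 0 < th -> \forall N \near \oo,
    (hyper_prob beta [set L : hypergraph N |
       (eps < `|(essential_on K L)%:R / N%:R - c|)%R] <= th%:E)%E.
  move=> th0; pose e2 := th * eps ^+ 2.
  have e20 : 0 < e2 by rewrite mulr_gt0 ?exprn_gt0.
  have eta0 : 0 < e2 / 4 by rewrite divr_gt0.
  have [N1 N1P] := completing_rate_concentration eta0.
  (* With [a = dl * N] the influence term is [2 * C * dl * N ^+ 2] plus a linear term. This, the
     variance of [W] and the linear terms each get a quarter of the allowance [e2 * N ^+ 2]. *)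
  pose dl := e2 / 8 / (C + 1).
  have dl0 : 0 < dl by rewrite !divr_gt0 //; lra.
  have Cdl : 2 * C * dl <= e2 / 4.
    have : C * dl <= e2 / 8.
      rewrite /dl mulrCA ler_piMr ?divr_ge0 ?(ltW e20) // ler_pdivrMr; lra.
    lra.
  have [N2 N2P'] := exists_nat_ge ((C + 2 * C ^+ 2 / dl) / (e2 / 4)).
  exists (N1 + N2).+1 => // N /= NN.
  have [Npos [N1N N2N]] : (0 < N /\ N1 <= N /\ N2 <= N)%N by move: NN; clear; lia.
  have N0 : (0 : R) < N%:R by rewrite ltr0n.
  have r0 := @hyper_rate_ge0 R beta N beta_ge0.
  have N2P : C + 2 * C ^+ 2 / dl <= e2 / 4 * N%:R.
    rewrite [leRHS]mulrC -ler_pdivrMr //; apply: le_trans N2P' _.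
    by rewrite ler_nat.
  rewrite hyper_probE.
  pose k := ((eps * N%:R) ^+ 2)^-1.
  have k0 : 0 < k by rewrite invr_gt0 exprn_gt0 // mulr_gt0.
  apply: (@le_trans _ _ (EE N (fun L => k * ((essential_on K L)%:R - c * N%:R) ^+ 2))).
    apply: le_hyper_expect => // L; case: (boolP (_ \in _)) => [|_]; last first.
      by rewrite mulr_ge0 ?sqr_ge0 // ltW.
    move=> /set_mem /= far; rewrite -[leLHS](mulVf (_ : (eps * N%:R) ^+ 2 != 0)); last first.
      by rewrite gt_eqF // exprn_gt0 // mulr_gt0.
    rewrite ler_wpM2l ?(ltW k0) // -[leRHS]real_normK ?num_real //.
    rewrite ler_sqr ?nnegrE ?mulr_ge0 ?(ltW eps0) ?(ltW N0) //.
    have -> : (essential_on K L)%:R - c * N%:R = ((essential_on K L)%:R / N%:R - c) * N%:R.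
      by rewrite mulrBl divfK // gt_eqF.
    by rewrite normrM [`|N%:R|]ger0_norm // ler_wpM2r // ltW.
  rewrite hyper_expectZ ?(ltW k0) //; last by move=> L; rewrite sqr_ge0.
  have a0 : 0 < dl * N%:R by rewrite mulr_gt0.
  have cN0 : 0 <= c * N%:R by rewrite mulr_ge0.
  have dev := essential_on_deviation beta_ge0 beta_sum N K cN0 a0.
  have {}dev := le_trans dev (leeD2r _ (N1P N N1N)).
  apply: le_trans (lee_wpmul2l _ dev) _; first by rewrite lee_fin ltW.
  rewrite -EFinD -EFinM lee_fin /k mulrC ler_pdivrMr ?exprn_gt0 ?mulr_gt0 //.
  have -> : th * (eps * N%:R) ^+ 2 = e2 * N%:R ^+ 2 by rewrite /e2 exprMn mulrA.
  have -> : C * N%:R + 2 * C * (N%:R * (dl * N%:R + C * N%:R / (dl * N%:R)))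
     = (C + 2 * C ^+ 2 / dl) * N%:R + 2 * C * dl * N%:R ^+ 2.
    by field; rewrite !gt_eqF.
  have : (C + 2 * C ^+ 2 / dl) * N%:R <= e2 / 4 * N%:R ^+ 2.
    by rewrite [N%:R ^+ 2]expr2 [leRHS]mulrA ler_wpM2r.
  have : 2 * C * dl * N%:R ^+ 2 <= e2 / 4 * N%:R ^+ 2 by rewrite ler_wpM2r ?sqr_ge0.
  have : 0 <= e2 / 4 * N%:R ^+ 2 by rewrite mulr_ge0 ?sqr_ge0 ?(ltW eta0).
  lra.
have prob0 N E : (0 <= @hyper_prob R beta N E)%E.
  by apply: esum_ge0 => L _; rewrite lee_fin hyper_mass_ge0 // => A; exact: hyper_rate_ge0.
apply/fine_cvgP; split.
  have := bound 1 ltr01; apply: filterS => N le1.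
  by rewrite ge0_fin_numE // (le_lt_trans le1) // ltry.
apply/cvgrPdist_le => th th0; have := bound th th0; apply: filterS => N leth.
have fin : hyper_prob beta [set L : hypergraph N |
    eps < `|(essential_on K L)%:R / N%:R - c|] \is a fin_num.
  by rewrite ge0_fin_numE // (le_lt_trans leth) // ltry.
by rewrite sub0r normrN ger0_norm ?fine_ge0 //= -lee_fin fineK.
Qed.

End RestrictDegrees.

(** * The two choices of sizes *)

Lemma essentialE N (L : hypergraph N) : essential L = essential_on (fun k => 0 < k)%N L.
Proof.
rewrite /essential /essential_on /essential_k.
pose F (A : {set 'I_N}) :=
  (if #|identifiable (remove_edge L A)| < #|identifiable L| then L A else 0)%N.
transitivity (\sum_(1 <= k < N.+1) \sum_(A : {set 'I_N}) if k == #|A| then F A else 0)%N.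
  by apply: eq_bigr => k _; rewrite big_mkcond; apply: eq_bigr => A _; rewrite eq_sym.
rewrite exchange_big /= [RHS]big_mkcond /=; apply: eq_bigr => A _.
have AN : (#|A| <= N)%N by rewrite -[X in (_ <= X)%N]card_ord max_card.
by rewrite -big_mkcond /= big_nat1_eq ltnS AN andbT.
Qed.

Lemma beta_deriv_pred1 (R : realType) (beta : nat -> R) k (t : R) : (1 <= k)%N ->
  beta_deriv (restrict_degrees beta (pred1 k)) t = k%:R * beta k * t ^+ k.-1.
Proof.
move=> k1; apply: lim_near_cst => //; near=> n.
have kn : (k < n)%N by near: n; exists k.+1.
under eq_bigr => i _ do rewrite /restrict_degrees /= (fun_if ( *%R i%:R)) mulr0
  (fun_if (fun x => x * t ^+ i.-1)) mul0r.
by rewrite -big_mkcond /= big_nat1_eq k1 kn.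
Unshelve. all: by end_near. Qed.

Lemma beta_deriv_pos (R : realType) (beta : nat -> R) (t : R) :
  beta_deriv (restrict_degrees beta (fun k => 0 < k)%N) t = beta_deriv beta t.
Proof.
congr (lim (_ @ \oo)); apply/funext => n; apply: eq_big_nat => k /andP[k0 _].
by rewrite /restrict_degrees k0.
Qed.

Theorem theorem3 (R : realType) (beta : nat -> R)
  (beta_ge0 : forall k, (1 <= k)%N -> 0 <= beta k)
  (beta_sum : cvgn (series (fun k => k%:R * beta k)))
  (no_zero : forall t : R, 0 <= t -> t < tstar beta ->
      beta_deriv beta t + ln (1 - t) != 0) :
  (forall k : nat, (1 <= k)%N -> forall eps : R, 0 < eps ->
     (fun N : nat => hyper_prob beta
        [set L : hypergraph N |
          eps < `| (essential_k L k)%:R / N%:R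
                   - k%:R * (1 - tstar beta) * tstar beta ^+ k.-1 * beta k |]%classic)
     @ \oo --> (0 : \bar R))
  /\
  (forall eps : R, 0 < eps ->
     (fun N : nat => hyper_prob beta
        [set L : hypergraph N |
          eps < `| (essential L)%:R / N%:R
                   - - ((1 - tstar beta) * ln (1 - tstar beta)) |]%classic)
     @ \oo --> (0 : \bar R)).
Proof.
split=> [k k1 eps eps0|eps eps0].
  have := essential_on_cvg beta_ge0 beta_sum no_zero (pred1 k) eps0.
  rewrite /essential_limit beta_deriv_pred1 //.
  rewrite (_ : (1 - tstar beta) * _ =
     k%:R * (1 - tstar beta) * tstar beta ^+ k.-1 * beta k); last by ring.
  by [].
have := essential_on_cvg beta_ge0 beta_sum no_zero (fun k => 0 < k)%N eps0.
(* At the threshold [beta_deriv] equals [- ln (1 - ts)], which yields the logarithmic form of the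
   limit. *)
rewrite /essential_limit beta_deriv_pos beta_deriv_tstar // mulrN.
by under eq_fun do under eq_set do rewrite -essentialE.
Qed.
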